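(* Let $X$ be a Helly graph with finite combinatorial dimension, and let $N \geq 1$ be an integer. Then there exists a simplicial structure on the injective hull $E(X)$ of $X$, denoted $O_N X$ (the $N^{\text{th}}$ orthoscheme subdivision complex of $X$), satisfying the following: \begin{itemize} \item Each simplex of $O_N X$, with the metric of $E(X)$, is isometric to the standard $\ell^\infty$ orthosimplex (of the same dimension) with edge lengths $\frac{1}{2\cdot N!}$. \item The vertex set $X'_N$ of $O_N X$, endowed with the distance induced from $E(X)$, is a Helly graph with edge lengths $\frac{1}{2\cdot N!}$ (two vertices being adjacent iff their distance is $\frac{1}{2\cdot N!}$), and it contains $X$ isometrically. Moreover, $$X'_N = \left\{p \in E(X) \,\middle|\, \forall x \in X,\ d(p,x) \in \tfrac{1}{2\cdot N!}\mathbb{N}\right\}.$$ \item For any $p \in E(X)$ and any simplex of $O_N X$ containing $p$ with vertices $x_1,\dots,x_n \in X'_N$, there exist unique $t_1,\dots,t_n \geq 0$ with $t_1+\dots+t_n=1$ such that $$\forall x \in X,\quad d(p,x)=\sum_{i=1}^n t_i\, d(x_i,x);$$ one writes $p=\sum_{i=1}^n t_i x_i$. More generally, if $p,p' \in E(X)$ satisfy $p=\sum_{i=1}^n t_i x_i$ and $p'=\sum_{i'=1}^{n'} t'_{i'} x'_{i'}$ in this sense (with respect to simplices of $O_N X$ containing them), then $$d(p,p') = \max_{x \in X} \sum_{i=1}^n \sum_{i'=1}^{n'} t_i t'_{i'}\, |d(x_i,x)-d(x'_{i'},x)|.$$ \end{itemize}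
   Context: A graph is identified with its vertex set, endowed with the graph (path) metric $d$ with edges of length $1$; the combinatorial ball is $B(x,r)=\{y : d(x,y)\le r\}$. A connected graph is Helly if every family of pairwise intersecting combinatorial balls has non-empty global intersection. For a metric space $X$, let $\Delta(X)$ be the set of functions $f:X\to\mathbb{R}$ with $f(x)+f(y)\ge d(x,y)$ for all $x,y$, and let $E(X)=\{f\in\Delta(X) : f(x)=\sup_{y\in X}(d(x,y)-f(y))\ \forall x\in X\}$, with the sup metric $d(f,g)=\sup_x|f(x)-g(x)|$; this is (Lang's model of) the injective hull of $X$, and $X$ embeds isometrically via $x\mapsto d(x,\cdot)$, so that $d(p,x)=p(x)$ for $p\in E(X)$, $x\in X$. The combinatorial dimension of $X$ is the dimension of $E(X)$. The standard $\ell^\infty$ orthosimplex of dimension $n$ with edge lengths $\ell>0$ is the simplex in $\mathbb{R}^n$ with vertices $(0,\dots,0),(\ell,0,\dots,0),(\ell,\ell,0,\dots,0),\dots,(\ell,\dots,\ell)$, with the $\ell^\infty$ metric. Here $\mathbb{N}=\{0,1,2,\dots\}$ and $2\cdot N!$ denotes $2$ times $N$ factorial.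
   Formalization: In the final formula for d(p,p') the absolute value is taken outside the double sum: max over x of |Σ Σ t_i t'_{i'} (d(x_i,x) − d(x'_{i'},x))|; as printed, it fails for p = p' the midpoint of an edge, where the right-hand side is positive. *)

(* Defs.v *)
From HB Require Import structures.
From mathcomp Require Import all_boot all_order all_algebra.
From mathcomp Require Import mathcomp_extra boolp classical_sets functions.
From mathcomp Require Import cardinality fsbigop reals topology normedtype.

Set Implicit Arguments.
Unset Strict Implicit.
Unset Printing Implicit Defensive.
Import Order.TTheory GRing.Theory Num.Theory.
Import numFieldNormedType.Exports.
Local Open Scope classical_set_scope.
Local Open Scope ring_scope.

Section Graphs.
Variables (X : Type) (e : rel X).

Definition has_walk (x y : X) (n : nat) : Prop :=
  exists s : seq X, [/\ path e x s, last x s = y & size s = n].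

(* Junk value 0 when no walk joins x to y. *)
Definition gdist (x y : X) : nat :=
  xget 0%N [set n | has_walk x y n /\
                    forall m, has_walk x y m -> (n <= m)%N].

Definition gball (x : X) (r : nat) : set X := [set y | (gdist x y <= r)%N].

(* Simple, connected, of arbitrary cardinality, not assumed locally finite. *)
Definition connected_graph : Prop :=
  [/\ symmetric e, irreflexive e, exists x : X, True
    & forall x y, exists n, has_walk x y n].

(* A family of balls is a set of (centre, radius) pairs; on the vertex set,
   balls of real radius r >= 0 are balls of radius floor(r). *)
Definition Helly_graph : Prop :=
  connected_graph /\
  forall F : set (X * nat),
    (forall b c, F b -> F c -> gball b.1 b.2 `&` gball c.1 c.2 !=set0) ->
    \bigcap_(b in F) gball b.1 b.2 !=set0.

End Graphs.

Definition gmetric (R : realType) (X : Type) (e : rel X) (x y : X) : R :=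
  (gdist e x y)%:R.

Section InjectiveHull.
Variables (R : realType) (X : Type) (d : X -> X -> R).

Definition Delta : set (X -> R) := [set f | forall x y, d x y <= f x + f y].

Definition hull : set (X -> R) :=
  [set f | Delta f /\
    forall x, f x = sup [set d x y - f y | y in [set: X]]].

Definition supdist (f g : X -> R) : R :=
  sup [set `|f x - g x| | x in [set: X]].

Definition embed (x : X) : X -> R := fun y => d x y.

End InjectiveHull.

Section CoveringDimension.
Variables (R : realType) (M : Type) (D : M -> M -> R) (A : set M).

Definition metric_open (U : set M) : Prop :=
  U `<=` A /\
  forall p, U p ->
    exists2 eps : R, 0 < eps & forall q, A q -> D p q < eps -> U q.

Definition finite_open_cover (k : nat) (U : 'I_k -> set M) : Prop :=
  (forall i, metric_open (U i)) /\ A `<=` \bigcup_i U i.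

(* Lebesgue covering dimension of the metric space (A, D) is at most n: every
   finite open cover has a finite open refinement, no point of A lying in more
   than n + 1 of its members. *)
Definition covering_dim_le (n : nat) : Prop :=
  forall (k : nat) (U : 'I_k -> set M), finite_open_cover U ->
  exists (m : nat) (V : 'I_m -> set M),
    [/\ finite_open_cover V,
        forall j, exists i, V j `<=` U i
      & forall (p : M) (J : {set 'I_m}),
          (forall j, j \in J -> V j p) -> (#|J| <= n.+1)%N].

End CoveringDimension.

Definition finite_combinatorial_dimension
    (R : realType) (X : Type) (d : X -> X -> R) : Prop :=
  exists n : nat, covering_dim_le (@supdist R X) (hull d) n.

Section SimplicialStructure.
Variables (R : realType) (M : choiceType) (D : M -> M -> R) (A : set M).

Definition abstract_complex (K : set (set M)) : Prop :=
  forall s, K s ->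
    [/\ finite_set s, s !=set0, s `<=` A
      & forall s', s' !=set0 -> s' `<=` s -> K s'].

Definition supp (t : M -> R) : set M := [set v | t v != 0].

(* Points of |K| are given by their barycentric coordinates. *)
Definition geometric_realization (K : set (set M)) : set (M -> R) :=
  [set t | [/\ K (supp t), forall v, 0 <= t v
             & \sum_(v \in [set: M]) t v = 1]].

Definition geometric_face (K : set (set M)) (s : set M) : set (M -> R) :=
  geometric_realization K `&` [set t | supp t `<=` s].

(* A simplicial structure on the metric space (A, D), with vertices points of
   A: an abstract simplicial complex K and a bijection |K| -> A, identifying
   each vertex with itself and continuous on every closed simplex (hence, by
   compactness, a homeomorphism from each closed simplex onto its image). *)
Record simplicial_structure := SimplicialStructure {
  simplices : set (set M);
  realize : (M -> R) -> M;
  simplices_complex : abstract_complex simplices;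
  realize_bij : set_bij (geometric_realization simplices) A realize;
  realize_vertex : forall v, simplices [set v] ->
    realize (fun w => (w == v)%:R) = v;
  realize_continuous : forall s, simplices s ->
    forall t, geometric_face simplices s t ->
    forall eps : R, 0 < eps -> exists2 eta : R, 0 < eta &
      forall t', geometric_face simplices s t' ->
        (forall v, `|t v - t' v| < eta) -> D (realize t) (realize t') < eps
}.

Definition vertices (S : simplicial_structure) : set M :=
  [set v | simplices S [set v]].

Definition closed_simplex (S : simplicial_structure) (s : set M) : set M :=
  realize S @` geometric_face (simplices S) s.

(* v_0, ..., v_{n-1} lists the elements of s without repetition. *)
Definition enumerates (n : nat) (v : 'I_n -> M) (s : set M) : Prop :=
  set_bij [set: 'I_n] s v.

End SimplicialStructure.

Definition convex_weights (R : realType) (n : nat) (t : 'I_n -> R) : Prop :=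
  (forall i, 0 <= t i) /\ \sum_i t i = 1.

Section Orthosimplex.
Variables (R : realType) (n : nat) (l : R).

Definition ortho_vertex (k : 'I_n.+1) : 'rV[R]_n :=
  \row_(j < n) (if (j < k)%N then l else 0).

Definition orthosimplex : set 'rV[R]_n :=
  [set u | exists2 t : 'I_n.+1 -> R,
             convex_weights t & u = \sum_k t k *: ortho_vertex k].

End Orthosimplex.

(* The closed simplex with vertex set s is isometric to the orthosimplex of the
   same dimension, vertices being sent to vertices; the norm of 'rV[R]_n is the
   sup norm. *)
Definition isometric_to_orthosimplex (R : realType) (M : choiceType)
    (D : M -> M -> R) (A : set M) (S : simplicial_structure D A)
    (l : R) (s : set M) : Prop :=
  exists (n : nat) (v : 'I_n.+1 -> M) (phi : M -> 'rV[R]_n),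
    [/\ enumerates v s,
        forall k, phi (v k) = ortho_vertex l k,
        set_bij (closed_simplex S s) (@orthosimplex R n l) phi
      & forall p q, closed_simplex S s p -> closed_simplex S s q ->
          `|phi p - phi q| = D p q].

(* The relation "D p q = l" on the type of points of V. *)
Definition edge_rel (R : realType) (M : Type) (D : M -> M -> R)
    (l : R) (V : set M) : rel V :=
  fun p q => D (val p) (val q) == l.

Definition is_max (R : realType) (A : set R) (m : R) : Prop :=
  A m /\ ubound A m.

(* Main.v *)
(* Scale by L = 2 N!, so that L d is even-valued, and write a coordinate of L p
   as 2a + s c with s = 1 or -1 and c in [0, 1] its fold value.  Monotone maps of
   R that commute with all symmetries y |-> 2k - y preserve the scaled hull.
   Rounding the fold values of p at the successive thresholds c_0 < c_1 < ...
   where they occur writes p as a convex combination of lattice points forming a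
   chain for the order "some even coordinates move to a neighbouring odd value";
   the simplices are the finite chains, and the weights are the gaps c_(i+1) - c_i.
   Conversely each point of a chain's convex hull is extremal, because one partner
   y of x serves all the vertices at once.
   Finitely many fold values occur: with n + 1 of them in (0, 1), stretching the
   gaps embeds an (n + 1)-simplex in the hull, and the KKM theorem (proved by mod 2
   Sperner cochains on iterated barycentric subdivisions) contradicts covering
   dimension at most n.
   The lattice points form a Helly graph because a minimal integer function above
   the pointwise infimum of a family of balls is extremal. *)

(* The factor 2 in [2 * N!] is what makes folding possible. After division by [l] the distances are
   even integers 2m, so the number d(x, y) - f(x), which bounds f(y) from below and is approached by
   f(y) for suitable y, becomes the reflection of f(x) / l in the integer m. A monotone map
   commuting with these reflections respects both conditions, and it fixes every integer.

   X is not assumed locally finite, so the suprema defining the hull need not be attained. Foldings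
   are therefore also required to be Lipschitz, in order to carry approximate partners to
   approximate partners; at lattice points exact partners exist by integrality.

   The dimension hypothesis concerns open covers of the whole hull, whereas KKM lives on a simplex
   inside it. The bridge is that the barycentric coordinates of the embedded simplex extend to
   Lipschitz functions on the hull with sum 1, each read off at no more than two points of X. *)
Require Import Defs.
From HB Require Import structures.
From mathcomp Require Import all_boot all_order all_algebra.
From mathcomp Require Import mathcomp_extra boolp classical_sets functions.
From mathcomp Require Import cardinality fsbigop reals topology normedtype.
From mathcomp Require Import sequences lra zify.

Set Implicit Arguments.
Unset Strict Implicit.
Unset Printing Implicit Defensive.
Import Order.TTheory GRing.Theory Num.Theory.
Import numFieldNormedType.Exports.
Local Open Scope classical_set_scope.
Local Open Scope ring_scope.

(** * Sperner's lemma and the KKM theorem *)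

Section Cochains.
Variable T : eqType.
Implicit Types (s u : seq T) (f g : seq T -> bool).

(* The coboundary with coefficients in Z/2, augmented in degree 0. *)
Fixpoint delta (s : seq T) (f : seq T -> bool) : bool :=
  if s is v :: s' then f s' (+) delta s' (fun u => f (v :: u)) else false.

Lemma eq_delta_in s f g :
  (forall u, subseq u s -> (size u).+1 = size s -> f u = g u) ->
  delta s f = delta s g.
Proof.
elim: s f g => //= v s IH f g fg; congr (_ (+) _).
  by apply: fg => //; apply: subseq_cons.
apply: IH => u us su; apply: fg => /=; last by rewrite su.
by rewrite eqxx.
Qed.

Lemma eq_delta s f g : f =1 g -> delta s f = delta s g.
Proof. by move=> fg; apply: eq_delta_in => u _ _; apply: fg. Qed.

Lemma delta_addb s f g :
  delta s (fun u => f u (+) g u) = delta s f (+) delta s g.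
Proof. by elim: s f g => //= v s IH f g; rewrite IH addbACA. Qed.

Lemma delta0 s : delta s (fun=> false) = false.
Proof. by elim: s. Qed.

Lemma delta_delta s f : delta s (delta^~ f) = false.
Proof.
elim: s f => //= v s IH f.
by rewrite (delta_addb s f (delta^~ (fun w => f (v :: w)))) IH addbF addbb.
Qed.

Lemma delta_exists s f :
  delta s f -> exists2 u, subseq u s & (size u).+1 = size s /\ f u.
Proof.
apply: contraPP => Nf; rewrite (@eq_delta_in _ _ (fun=> false)) ?delta0//.
move=> u us su; apply/negbTE/negP => fu; apply: Nf; exists u => //.
Qed.

(** Deleting an entry [a] leaves a permutation of [b] exactly when [s] is a permutation of [a :: b],
    so the count runs over the positions of such entries. *)
Lemma delta_perm_eq s b :
  delta s (fun u => perm_eq u b) = odd (count (fun a => perm_eq s (a :: b)) s).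
Proof.
(* [w] holds the entries already passed over, which all later deletions keep. *)
suff H w : delta s (fun u => perm_eq (w ++ u) b) =
    odd (count (fun a => perm_eq (w ++ s) (a :: b)) s) by exact: (H [::]).
elim: s w => //= v s IH w; rewrite oddD.
rewrite (eq_delta s (g := fun u => perm_eq (rcons w v ++ u) b)); last first.
  by move=> u; rewrite cat_rcons.
rewrite IH; congr (_ (+) _); last by rewrite cat_rcons.
by rewrite oddb -cat1s perm_catCA perm_cons.
Qed.

Variable c : seq T -> T.

(* Evaluation of a cochain on the iterated cone subdivision: a simplex is coned
   from the point [c s] over its subdivided boundary. *)
Fixpoint subdiv_rec (n : nat) (f : seq T -> bool) (s : seq T) : bool :=
  if n is m.+1 then delta s (subdiv_rec m (fun u => f (c s :: u)))
  else f [::].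

Definition subdiv f s := subdiv_rec (size s) f s.

Lemma eq_subdiv_rec n f g s : f =1 g -> subdiv_rec n f s = subdiv_rec n g s.
Proof.
elim: n f g s => [|n IH] f g s fg /=; first exact: fg.
by apply: eq_delta => u; apply: IH => w; apply: fg.
Qed.

Lemma subdiv_rec_addb n f g s : subdiv_rec n (fun u => f u (+) g u) s =
  subdiv_rec n f s (+) subdiv_rec n g s.
Proof.
elim: n f g s => //= n IH f g s; rewrite -delta_addb.
by apply: eq_delta => u; rewrite IH.
Qed.

(** Dual form of the fact that subdivision is a chain map. The boundary of a cone is its base plus
    the cone over the boundary of the base; the base is itself a subdivided boundary, so the second
    term is a double boundary and vanishes by [delta_delta]. *)
Lemma subdiv_rec_delta n f s : size s = n.+1 ->
  subdiv_rec n.+1 (delta^~ f) s = delta s (subdiv_rec n f).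
Proof.
elim: n f s => [|n IH] f s ss.
  by case: s ss => [//|a [|//]] _ /=; rewrite !addbF.
rewrite -[LHS]/(delta s (subdiv_rec n.+1 (fun u => f u (+) delta u (fun w => f (c s :: w))))).
rewrite (@eq_delta_in _ _ (fun u => subdiv_rec n.+1 f u (+)
   delta u (subdiv_rec n (fun w => f (c s :: w))))); last first.
  move=> u _ su; rewrite -IH; last by apply: succn_inj; rewrite su.
  by rewrite -subdiv_rec_addb.
by rewrite delta_addb delta_delta addbF.
Qed.

Lemma subdiv_delta f s : subdiv (delta^~ f) s = delta s (subdiv f).
Proof.
case: (posnP (size s)) => [/size0nil->//|].
rewrite /subdiv; case E : (size s) => [//|n] _; rewrite subdiv_rec_delta//.
by apply: eq_delta_in => u _; rewrite E => -[->].
Qed.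

(** A convexity notion adapted to the cone points: if such a [Q] contains the vertices of [s], it
    contains all vertices of the subdivision of [s]. *)
Definition cone_closed (Q : T -> Prop) : Prop :=
  forall u, (0 < size u)%N -> (forall y, y \in u -> Q y) -> Q (c u).

Lemma eq_subdiv_in (Q : T -> Prop) f g s : cone_closed Q ->
  (forall y, y \in s -> Q y) ->
  (forall u, size u = size s -> (forall y, y \in u -> Q y) -> f u = g u) ->
  subdiv f s = subdiv g s.
Proof.
move=> cQ; rewrite /subdiv; move E : (size s) => n.
elim: n f g s E => [|n IH] f g s E sQ fg /=; first by apply: fg.
apply: eq_delta_in => u us; rewrite E => -[su].
have uQ y : y \in u -> Q y by move=> /(mem_subseq us); apply: sQ.
apply: IH => // w sw wQ; apply: fg; first by rewrite /= sw.
by move=> y; rewrite inE => /predU1P[->|/wQ//]; apply: cQ; rewrite ?E.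
Qed.

End Cochains.

Lemma delta_map (T T' : eqType) (h : T -> T') s f :
  delta s (fun u => f (map h u)) = delta (map h s) f.
Proof. by elim: s f => //= v s IH f; rewrite (IH (fun u => f (h v :: u))). Qed.

(* Sperner's door counting: a full facet of [l] comes from exactly one position
   when [l] is full, and from exactly two equal entries of [l] otherwise. *)
Lemma delta_iota (l : seq nat) j : size l = j.+1 -> all (fun a => a < j.+1)%N l ->
  delta l (fun u => perm_eq u (iota 0 j)) = perm_eq l (iota 0 j.+1).
Proof.
move=> sl /allP lj; rewrite delta_perm_eq.
have iotaE : perm_eq (iota 0 j.+1) (j :: iota 0 j).
  by rewrite -addn1 iotaD cats1 perm_rcons.
have [full|nfull] := boolP (perm_eq l (iota 0 j.+1)).
  have lE : perm_eq l (j :: iota 0 j) by apply: perm_trans full iotaE.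
  rewrite (@eq_count _ _ (pred1 j)).
    by rewrite (permP full) count_uniq_mem ?iota_uniq// mem_iota leq0n add0n ltnSn.
  move=> a; apply/idP/idP => [|/eqP->//].
  rewrite (permPl lE) => /permP/(_ (pred1 a)) /eqP /=; rewrite eqxx.
  by rewrite eqn_add2r => /eqP; case: eqVneq.
have [[a0 la0 a0E]|none] :=
    pselect (exists2 a, a \in l & perm_eq l (a :: iota 0 j)); last first.
  rewrite (@eq_in_count _ _ pred0) ?count_pred0// => a la.
  by apply/negbTE/negP => aE; apply: none; exists a.
rewrite (@eq_count _ _ (pred1 a0)).
  rewrite (permP a0E) /= eqxx count_uniq_mem ?iota_uniq// mem_iota /= add0n.
  have : (a0 < j.+1)%N by apply: lj.
  rewrite ltnS leq_eqVlt => /predU1P[aj|->//].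
  by move: nfull; rewrite (permPr iotaE) -[X in X :: _]aj a0E.
move=> a; apply/idP/idP => [|/eqP->//].
rewrite (permPl a0E) => /permP/(_ (pred1 a)) /eqP /=; rewrite eqxx.
by rewrite eqn_add2r => /eqP; case: eqVneq.
Qed.

Section IteratedSubdivision.
Variables (T : eqType) (c : seq T -> T).
Implicit Types (s u : seq T) (f g : seq T -> bool).

Lemma eq_iter_subdiv_in r (Q : T -> Prop) f g s : cone_closed c Q ->
  (forall y, y \in s -> Q y) ->
  (forall u, size u = size s -> (forall y, y \in u -> Q y) -> f u = g u) ->
  iter r (subdiv c) f s = iter r (subdiv c) g s.
Proof.
move=> cQ; elim: r s => [|r IH] s sQ fg /=; first exact: fg.
apply: (eq_subdiv_in cQ) => // u su uQ; apply: IH => // w sw.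
by apply: fg; rewrite sw.
Qed.

Lemma iter_subdiv_delta r f s :
  iter r (subdiv c) (fun u => delta u f) s =
  delta s (iter r (subdiv c) f).
Proof.
elim: r s => //= r IH s; rewrite -subdiv_delta.
by apply: eq_subdiv_rec => u; apply: IH.
Qed.

Lemma iter_subdiv0 r s : iter r (subdiv c) (fun=> false) s = false.
Proof.
have E : subdiv c (fun=> false) =1 (fun=> false).
  move=> u; rewrite /subdiv; move: (size u) => n.
  elim: n u => //= n IH u.
  by rewrite (eq_delta _ (g := fun=> false)) ?delta0// => w; exact: IH.
elim: r s => //= r IH s.
by rewrite /subdiv (eq_subdiv_rec c _ _ IH) [LHS]E.
Qed.

End IteratedSubdivision.

(** * Mesh of iterated barycentric subdivisions *)

Section Barycentre.
Variables (R : realType) (V : normedModType R).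
Implicit Types (s u : seq V) (f : seq V -> bool).

Definition bary s : V := (size s)%:R^-1 *: \sum_(y <- s) y.

Lemma baryB s z : (0 < size s)%N ->
  bary s - z = (size s)%:R^-1 *: \sum_(y <- s) (y - z).
Proof.
move=> s0; rewrite /bary big_split/= big_const_seq count_predT iter_addr_0.
rewrite scalerDr; congr (_ + _).
rewrite -[X in _ *: X]scaler_nat scalerA mulVf ?scale1r//.
by rewrite pnatr_eq0 -lt0n.
Qed.

Lemma cone_closed_ball z (r : R) : cone_closed bary (fun y => `|y - z| <= r).
Proof.
move=> u u0 uQ; rewrite baryB// normrZ ger0_norm ?invr_ge0//.
rewrite ler_pdivrMl ?ltr0n//; apply: (le_trans (ler_norm_sum _ _ _)).
rewrite mulr_natl -[in leRHS](count_predT u) -iter_addr_0 -big_const_seq.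
by rewrite [leLHS]big_seq [leRHS]big_seq; apply: ler_sum.
Qed.

(** The term of [z] itself vanishes in the average, so only [size s - 1] of the [size s] terms
    contribute. *)
Lemma bary_dist s z (d : R) : z \in s -> (forall y, y \in s -> `|y - z| <= d) ->
  `|bary s - z| <= (1 - (size s)%:R^-1) * d.
Proof.
move=> zs sd; have s0 : (0 < size s)%N by case: s zs {sd}.
have s0R : 0 < (size s)%:R :> R by rewrite ltr0n.
rewrite baryB// normrZ ger0_norm ?invr_ge0//.
rewrite ler_pdivrMl// mulrA mulrBr mulr1 divff ?gt_eqF//.
rewrite (big_rem z)//= subrr add0r.
have -> : (size s)%:R - 1 = (size (rem z s))%:R :> R.
  by rewrite size_rem// -subn1 natrB.
apply: (le_trans (ler_norm_sum _ _ _)).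
rewrite mulr_natl -[in leRHS](count_predT (rem z s)) -iter_addr_0 -big_const_seq.
rewrite [leLHS]big_seq [leRHS]big_seq; apply: ler_sum => y /mem_rem; exact: sd.
Qed.

(** A nonzero value of a subdivided cochain is witnessed by a cell [u] of the subdivision. The bound
    [K], in place of [size s], keeps the contraction factor the same for all faces met in the
    recursion. *)
Lemma subdiv_mesh (K : nat) f s (d : R) : (size s <= K)%N ->
  (forall y z, y \in s -> z \in s -> `|y - z| <= d) -> subdiv bary f s ->
  exists u, [/\ size u = size s, f u,
    forall Q, cone_closed bary Q -> (forall y, y \in s -> Q y) ->
              forall y, y \in u -> Q y
    & forall y z, y \in u -> z \in u -> `|y - z| <= (1 - K%:R^-1) * d].
Proof.
rewrite /subdiv; move E : (size s) => n nK.
elim: n f s E nK => [|n IH] f s E nK sd /= Sf.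
  by exists [::]; split.
have K0 : 0 < K%:R :> R by rewrite ltr0n (leq_trans _ nK).
have d0 : 0 <= d.
  by case: s E sd {Sf} => // a s _ /(_ a a); rewrite mem_head subrr normr0; apply.
have cd0 : 0 <= (1 - K%:R^-1) * d.
  by rewrite mulr_ge0// subr_ge0 invf_le1// ler1n (leq_trans _ nK).
have [u us [su Su]] := delta_exists Sf.
have {}us y : y \in u -> y \in s by apply: mem_subseq.
have [||w [sw fw wQ wd]] := IH (fun w => f (bary s :: w)) u _ (ltnW nK) _ Su.
- by apply: succn_inj; rewrite su.
- by move=> y z /us ys /us zs; apply: sd.
(* The other vertices [w] come from subdividing a face whose vertices lie in a ball around the
   barycentre, and balls are cone-closed. *)
have bd y : y \in w -> `|y - bary s| <= (1 - K%:R^-1) * d.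
  move: y; apply: wQ; first exact: cone_closed_ball.
  move=> y /us ys; rewrite distrC.
  apply: le_trans (bary_dist ys (fun z zs => sd z y zs ys)) _.
  rewrite E; apply: ler_wpM2r => //.
  by rewrite lerB// lef_pV2// ?posrE ?ltr0n// ler_nat.
exists (bary s :: w); split => //.
- by rewrite /= sw.
- move=> Q cQ sQ y; rewrite inE => /predU1P[->|].
    by apply: cQ; rewrite ?E.
  by move: y; apply: wQ => // y /us /sQ.
- move=> y z; rewrite !inE => /predU1P[->|yw] /predU1P[->|zw].
  + by rewrite subrr normr0.
  + by rewrite distrC; apply: bd.
  + exact: bd.
  + exact: wd.
Qed.

Lemma iter_subdiv_mesh r (K : nat) f s (d : R) : (size s <= K)%N ->
  (forall y z, y \in s -> z \in s -> `|y - z| <= d) ->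
  iter r (subdiv bary) f s ->
  exists u, [/\ size u = size s, f u,
    forall Q, cone_closed bary Q -> (forall y, y \in s -> Q y) ->
              forall y, y \in u -> Q y
    & forall y z, y \in u -> z \in u -> `|y - z| <= (1 - K%:R^-1) ^+ r * d].
Proof.
elim: r s d => [|r IH] s d sK sd; first by exists s; split => //; rewrite ?mul1r.
move=> /(subdiv_mesh sK sd)[u [su fu uQ ud]].
have [|w [sw fw wQ wd]] := IH u _ _ ud fu; first by rewrite su.
exists w; split => //; first by rewrite sw.
  by move=> Q cQ sQ; apply: wQ => //; apply: uQ.
by move=> y z yw zw; rewrite exprSr -mulrA; apply: wd.
Qed.

End Barycentre.

(** * Sperner labellings of the standard simplex *)

Section KKM.
Variables (R : realType) (k : nat).
Implicit Types (y : 'rV[R]_k).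

Definition std_simplex : set 'rV[R]_k :=
  [set y | (forall i, 0 <= y 0 i) /\ \sum_i y 0 i = 1].

Definition std_face (j : nat) : set 'rV[R]_k :=
  std_simplex `&` [set y | forall i : 'I_k, (j <= i)%N -> y 0 i = 0].

Lemma cone_closed_simplex : cone_closed (@bary R _) std_simplex.
Proof.
move=> u u0 uQ; rewrite /std_simplex /bary; split=> [i|].
  rewrite mxE summxE mulr_ge0 ?invr_ge0// big_seq sumr_ge0// => y /uQ[+ _].
  exact.
under eq_bigr do rewrite mxE summxE; rewrite -mulr_sumr exchange_big/=.
rewrite big_seq (eq_bigr (fun=> 1)) => [|y /uQ[]//].
rewrite -big_seq big_const_seq count_predT iter_addr_0 mulVf//.
by rewrite pnatr_eq0 -lt0n.
Qed.

Lemma cone_closed_coord (i : 'I_k) :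
  cone_closed (@bary R _) [set y : 'rV[R]_k | y 0 i = 0].
Proof.
by move=> u u0 uQ; rewrite /bary/= mxE summxE big_seq big1 ?mulr0//.
Qed.

Lemma cone_closed_face j : cone_closed (@bary R _) (std_face j).
Proof.
move=> u u0 uQ; split; first by apply: cone_closed_simplex => // y /uQ[].
by move=> i ji; apply: cone_closed_coord => // y /uQ[_]; apply.
Qed.

Definition std_vertex (i : nat) : 'rV[R]_k := \row_j (j == i :> nat)%:R.

(** Reversed so that the head is the newest vertex: deleting it leaves the list of the previous
    face, as the induction of [sperner_full] requires. *)
Definition std_vertices (j : nat) : seq 'rV[R]_k := rev (mkseq std_vertex j).

Lemma std_verticesS j :
  std_vertices j.+1 = std_vertex j :: std_vertices j.
Proof. by rewrite /std_vertices mkseqS rev_rcons. Qed.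

Lemma mem_std_vertices j y :
  y \in std_vertices j -> exists2 i, (i < j)%N & y = std_vertex i.
Proof.
rewrite mem_rev => /mapP[i]; rewrite mem_iota => /andP[_ ij] ->.
by exists i.
Qed.

Lemma std_vertex_face i j : (i < j <= k)%N -> std_face j (std_vertex i).
Proof.
move=> /andP[ij jk]; have ik := leq_trans ij jk.
split=> [|a ja]; last by rewrite mxE gtn_eqF// (leq_trans ij).
split=> [a|]; first by rewrite mxE.
rewrite (bigD1 (Ordinal ik))//= mxE eqxx big1 ?addr0// => a ai.
by rewrite mxE (negbTE (ai : a != i :> nat)).
Qed.

Lemma std_vertices_face j y : (j <= k)%N -> y \in std_vertices j -> std_face j y.
Proof.
by move=> jk /mem_std_vertices[i ij ->]; apply: std_vertex_face; rewrite ij.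
Qed.

Variable lab : 'rV[R]_k -> 'I_k.
Hypothesis labP : forall y, std_simplex y -> y 0 (lab y) != 0.

Let full j u := perm_eq (map (fun y => lab y : nat) u) (iota 0 j).

(** The parity count of fully labelled cells, by induction on faces. On the face of the first [j.+1]
    vertices all labels are at most [j], so being full is the coboundary of being full one dimension
    lower, and subdivision commutes with coboundaries. The facet opposite the last vertex counts 1
    by induction; on any other facet some coordinate [i < j] vanishes, so the label [i] does not
    occur and the count is 0. *)
Lemma sperner_full r j : (j <= k)%N ->
  iter r (subdiv (@bary R _)) (full j) (std_vertices j).
Proof.
elim: j => [_|j IH jk].
  elim: r => // r IH /=.
have lab_face y : std_face j.+1 y -> (lab y < j.+1)%N.
  move=> [sy yj]; rewrite ltnNge; apply/negP => /yj ly0.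
  by have := labP sy; rewrite ly0 eqxx.
rewrite (@eq_iter_subdiv_in _ _ r (std_face j.+1) _ (fun u => delta u (full j)));
  first last.
- move=> u su uF; rewrite /full (delta_map _ _ (fun w => perm_eq w (iota 0 j))).
  rewrite delta_iota//; first by rewrite size_map su size_rev size_mkseq.
  by rewrite all_map; apply/allP => y /uF /lab_face.
- by move=> y; apply: std_vertices_face.
- exact: cone_closed_face.
rewrite iter_subdiv_delta std_verticesS/= IH ?(ltnW jk)//=.
rewrite (@eq_delta_in _ _ _ (fun=> false)) ?delta0// => u us su.
have vu : uniq (std_vertices j).
  rewrite rev_uniq map_inj_in_uniq ?iota_uniq// => a b.
  rewrite !mem_iota/= !add0n => aj _ /rowP/(_ (Ordinal (leq_trans aj (ltnW jk)))).
  rewrite !mxE/= eqxx; case: (eqVneq a b) => // _ /eqP.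
  by rewrite oner_eq0.
have [i ij iu] : exists2 i, (i < j)%N & std_vertex i \notin u.
  apply: contrapT => Nu.
  have /(uniq_leq_size vu) : {subset std_vertices j <= u}.
    move=> _ /mem_std_vertices[i ij ->]; apply: contrapT => /negP iu.
    by apply: Nu; exists i.
  by rewrite -su ltnn.
have ik : (i < k)%N by apply: ltn_trans jk.
rewrite (@eq_iter_subdiv_in _ _ r
  (std_simplex `&` [set y | y 0 (Ordinal ik) = 0]) _ (fun=> false)).
- exact: iter_subdiv0.
- move=> w w0 wQ; split; first by apply: cone_closed_simplex => // y /wQ[].
  by apply: cone_closed_coord => // y /wQ[].
- move=> y; rewrite inE => /predU1P[->|yu].
    split; first by have [] := @std_vertex_face j j.+1; rewrite ?ltnSn.
    by rewrite /= mxE/= ltn_eqF.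
  have /mem_std_vertices[a aj ya] : y \in std_vertices j by apply: (mem_subseq us).
  split.
    rewrite ya; have [] := @std_vertex_face a j.+1; rewrite ?jk ?andbT//.
    exact: ltnW.
  rewrite ya /= mxE/=; case: eqVneq => // ia.
  by move: iu; rewrite ia -ya yu.
- move=> w sw wQ; apply/negbTE/negP => /perm_mem/(_ i).
  rewrite mem_iota leq0n add0n ij => /mapP[y /wQ[sy /= y0] il].
  have := labP sy; suff -> : lab y = Ordinal ik by rewrite y0 eqxx.
  exact: val_inj.
Qed.

Lemma sperner (eps : R) : 0 < eps -> exists u : seq 'rV[R]_k,
  [/\ forall y, y \in u -> std_simplex y,
      forall i, exists2 y, y \in u & lab y = i
    & forall y z, y \in u -> z \in u -> `|y - z| <= eps].
Proof.
move=> eps0; case: (posnP k) => [k0|k0].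
  by exists [::]; split=> // i; have := ltn_ord i; rewrite {2}k0.
pose q : R := 1 - k%:R^-1.
have q1 : `|q| < 1.
  rewrite /q ger0_norm ?subr_ge0 ?invf_le1 ?ler1n ?ltr0n//.
  by rewrite ltrBlDr ltrDl invr_gt0 ltr0n.
have [M M0 HM] : exists2 M : R, 0 < M & forall y z, y \in std_vertices k ->
    z \in std_vertices k -> `|y - z| <= M.
  pose M := 1 + \sum_(y <- std_vertices k) \sum_(z <- std_vertices k) `|y - z|.
  have n0 (s : seq 'rV[R]_k) (F : 'rV[R]_k -> R) y :
      (forall y, 0 <= F y) -> y \in s -> F y <= \sum_(y <- s) F y.
    by move=> F0 ys; rewrite (big_rem y)//= lerDl sumr_ge0.
  exists M; first by rewrite ltr_pwDl// sumr_ge0// => y _; rewrite sumr_ge0.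
  move=> y z yk zk; rewrite /M.
  apply: (@le_trans _ _ (\sum_(z <- std_vertices k) `|y - z|)).
    exact: (n0 _ (fun z => `|y - z|)).
  apply: le_trans (n0 _ (fun y => \sum_(z <- std_vertices k) `|y - z|) _ _ yk) _.
    by move=> a; rewrite sumr_ge0.
  by rewrite lerDr.
have [r qr] : exists r : nat, `|q ^+ r| < eps / M.
  have /cvgrPdist_lt/(_ (eps / M)) := cvg_geometric 1 q1.
  move=> /(_ (divr_gt0 eps0 M0))[r _ /(_ r (leqnn r))]/=.
  by rewrite sub0r normrN mul1r; exists r.
have sk : (size (std_vertices k) <= k)%N by rewrite size_rev size_mkseq.
have [u [su fu uQ ud]] := iter_subdiv_mesh sk HM (sperner_full r (leqnn k)).
exists u; split.
- move=> y /(uQ _ cone_closed_simplex); apply=> z zk.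
  by have [] := std_vertices_face (leqnn k) zk.
- move=> i; have /perm_mem/(_ (i : nat)) := fu.
  rewrite mem_iota/= add0n ltn_ord => /mapP[y yu iy]; exists y => //.
  exact/esym/val_inj.
- move=> y z yu zu; apply: le_trans (ud _ _ yu zu) _.
  rewrite -ler_pdivlMr//; apply/ltW; apply: le_lt_trans qr; exact: ler_norm.
Qed.

End KKM.

Lemma rV_coord_le (R : realType) n (x : 'rV[R]_n) i : `|x 0 i| <= `|x|.
Proof.
rewrite [leRHS](_ : _ = mx_norm x)// mx_normrE.
exact: (le_bigmax _ (fun ij : 'I_1 * 'I_n => `|x ij.1 ij.2|) (0, i)).
Qed.

Lemma rV_norm_le (R : realType) n (x : 'rV[R]_n) (r : R) :
  0 <= r -> (forall i, `|x 0 i| <= r) -> `|x| <= r.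
Proof.
move=> r0 xr; rewrite [leLHS](_ : _ = mx_norm x)// mx_normrE.
by apply: bigmax_le => // -[a i] _ /=; rewrite ord1.
Qed.

(** Lebesgue number of the cover, by compactness of the cube [0, 1]^k; a point of the cube outside
    the simplex gets a neighbourhood missing the simplex. *)
Lemma std_simplex_lebesgue (R : realType) (k : nat) (W : 'I_k -> set 'rV[R]_k) :
  (forall y, std_simplex y -> exists i, W i y) ->
  (forall i y, std_simplex y -> W i y -> exists2 eps : R, 0 < eps &
     forall z, std_simplex z -> `|y - z| < eps -> W i z) ->
  exists2 eps : R, 0 < eps & forall y, std_simplex y ->
    exists i, forall z, std_simplex z -> `|y - z| < eps -> W i z.
Proof.
move=> Wcov Wopen.
have /compact_near_coveringP cpt :
    compact [set v : 'rV[R]_k | forall i, v ord0 i \in `[0 : R, 1]].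
  by apply: (@rV_compact _ _ (fun=> `[0 : R, 1]%classic)) => i; exact: segment_compact.
have ballE (x y : 'rV[R]_k) (r : R) : ball x r y = (`|x - y| < r) :> Prop.
  by rewrite -ball_normE.
pose P (e : R) (y : 'rV[R]_k) := std_simplex y ->
  exists i, forall z, std_simplex z -> `|y - z| < e -> W i z.
have [|e /= e0 He] := cpt R 0^'+ P _.
  move=> x cx; have [sx|nsx] := pselect (std_simplex x).
    have [i Wix] := Wcov _ sx; have [eps eps0 Heps] := Wopen _ _ sx Wix.
    exists (ball x (eps / 2), [set e | e < eps / 2]).
      split; first by apply: (nbhsx_ballx x (eps / 2)); rewrite divr_gt0.
      by apply: nbhs_right_lt; rewrite divr_gt0.
    move=> [y e] /= []; rewrite ballE => xy ee sy; exists i => z sz yz.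
    apply: Heps => //; rewrite -[x](subrK y) -addrA [eps]splitr.
    by apply: (le_lt_trans (ler_normD _ _)); rewrite ltrD// (lt_trans yz).
  have sum1 : 0 < `|\sum_i x 0 i - 1|.
    rewrite normr_gt0 subr_eq0; apply/eqP => sx1; apply: nsx; split => // i.
    by have := cx i; rewrite /= in_itv/= => /andP[].
  have k1 : 0 < k.+1%:R :> R by rewrite ltr0n.
  (* The coordinate sum is [k]-Lipschitz for the sup norm, so no point of the simplex is this close
     to [x]; [k.+1] keeps the divisor positive when [k] is 0. *)
  exists (ball x (`|\sum_i x 0 i - 1| / k.+1%:R), setT).
    split; last exact: filterT.
    by apply: (nbhsx_ballx x _); rewrite divr_gt0.
  move=> [y e] /= []; rewrite ballE => xy _ [_ sy]; exfalso.
  have dE : \sum_i x 0 i - 1 = \sum_i x 0 i - \sum_i y 0 i by rewrite sy.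
  move: xy; rewrite dE -sumrB ltr_pdivlMr// ltNge => /negP; apply.
  apply: (le_trans (ler_norm_sum _ _ _)).
  apply: (@le_trans _ _ (\sum_(i < k) `|x - y|)).
    apply: ler_sum => i _.
    by apply: le_trans (rV_coord_le _ i); rewrite !mxE.
  rewrite sumr_const card_ord -[leLHS]mulr_natr ler_wpM2l// ler_nat//.
exists (e / 2); first by rewrite divr_gt0.
move=> y sy; have := He (e / 2); rewrite /ball/= sub0r normrN gtr0_norm ?divr_gt0//.
rewrite ltr_pdivrMr// ltr_pMr// ltr1n => /(_ isT).
move=> /(_ isT y); apply => // i; rewrite /= in_itv/=.
case: sy => y0 y1; rewrite y0 -y1 (bigD1 i)//= lerDl.
by rewrite sumr_ge0.
Qed.

(* A cover of the simplex whose i-th member misses the i-th face has a common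
   point: near each point of a Sperner labelling at the Lebesgue scale, all
   members of the cover meet. *)
Lemma kkm (R : realType) (k : nat) (W : 'I_k.+1 -> set 'rV[R]_k.+1) :
  (forall y, std_simplex y -> exists i, W i y) ->
  (forall i y, std_simplex y -> W i y -> exists2 eps : R, 0 < eps &
     forall z, std_simplex z -> `|y - z| < eps -> W i z) ->
  (forall i y, std_simplex y -> W i y -> y 0 i != 0) ->
  exists2 y, std_simplex y & forall i, W i y.
Proof.
move=> Wcov Wopen Wface.
have [eps eps0 Heps] := std_simplex_lebesgue Wcov Wopen.
pose near_in y i := forall z, std_simplex z -> `|y - z| < eps -> W i z.
pose lab y := xget ord0 [set i | near_in y i].
have labP y : std_simplex y -> near_in y (lab y).
  by move=> /Heps[i ni]; rewrite /lab; case: xgetP => [j _ //|/(_ i)].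
have [|u [su lu ud]] := @sperner _ _ lab _ (eps / 2) (divr_gt0 eps0 (ltr0Sn _ 1)).
  move=> y sy; apply: Wface => //; apply: (labP y) => //.
  by rewrite subrr normr0.
have [y yu _] := lu ord0; exists y; first exact: su.
move=> i; have [z zu <-] := lu i; apply: (labP z); first exact: su.
  exact: su.
apply: le_lt_trans (ud _ _ zu yu) _.
by rewrite ltr_pdivrMr// ltr_pMr// ltr1n.
Qed.

(** * Folding maps *)

Section Ramps.
Variable R : realType.
Implicit Types (a b u v y : R).

(** The increasing affine map from [a, b] onto [0, 1], clamped outside. Writing it with minima makes
    the sum in [sum_fold_ramp] telescope. *)
Definition ramp a b u : R := (Num.min u b - Num.min u a) / (b - a).

Lemma ramp_lip a b u v : a < b -> u <= v ->
  0 <= ramp a b v - ramp a b u <= (v - u) / (b - a).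
Proof.
move=> ab uv; rewrite /ramp -mulrBl; have ba : 0 < b - a by rewrite subr_gt0.
rewrite ler_pM2r ?invr_gt0// mulr_ge0 ?invr_ge0 ?(ltW ba)//=;
  by case: (leP v b); case: (leP v a); case: (leP u b); case: (leP u a); lra.
Qed.

Lemma ramp0 a b u : a < b -> u <= a -> ramp a b u = 0.
Proof.
by move=> ab ua; rewrite /ramp !min_l ?subrr ?mul0r// (le_trans ua)// ltW.
Qed.

Lemma ramp1 a b u : a < b -> b <= u -> ramp a b u = 1.
Proof.
move=> ab bu; rewrite /ramp !min_r ?divff// ?subr_eq0 ?gt_eqF//.
by rewrite (le_trans _ bu)// ltW.
Qed.

Definition odd_ramp a b u : R := ramp a b u - ramp a b (- u).

Lemma odd_rampN a b u : odd_ramp a b (- u) = - odd_ramp a b u.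
Proof. by rewrite /odd_ramp opprK opprB. Qed.

Lemma odd_ramp_lip a b u v : a < b -> u <= v ->
  0 <= odd_ramp a b v - odd_ramp a b u <= 2 / (b - a) * (v - u).
Proof.
move=> ab uv; have /andP[h1 h2] := ramp_lip ab uv.
have /andP[h3 h4] : 0 <= ramp a b (- u) - ramp a b (- v) <= (v - u) / (b - a).
  by rewrite (_ : v - u = - u - - v) ?ramp_lip ?lerN2// opprK addrC.
rewrite /odd_ramp mulrAC -mulrA; apply/andP; split; lra.
Qed.

Lemma odd_ramp1 a b u : 0 <= a -> a < b -> b <= u -> odd_ramp a b u = 1.
Proof.
by move=> a0 ab bu; rewrite /odd_ramp ramp1// ramp0 ?subr0//; lra.
Qed.

Lemma odd_ramp0 a b u : a < b -> `|u| <= a -> odd_ramp a b u = 0.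
Proof.
by rewrite ler_norml => ab /andP[u1 u2]; rewrite /odd_ramp !ramp0 ?subrr//; lra.
Qed.

(** Twice this is an even integer nearest to [y]; an odd [y] is a tie and goes up. *)
Definition even_part y : int := Num.floor ((y + 1) / 2).

Lemma even_partP y : `|y - 2 * (even_part y)%:~R| <= 1.
Proof.
have /andP[] := floor_itv ((y + 1) / 2).
by rewrite -/(even_part y) intrD ler_norml; lra.
Qed.

(* The map R -> R fixing the integers, commuting with the symmetries
   [y |-> 2k - y], whose restriction to [0, 1] is [ramp a b]. *)
Definition fold_ramp a b y : R :=
  2 * (even_part y)%:~R + odd_ramp a b (y - 2 * (even_part y)%:~R).

Lemma fold_rampE a b y (e : int) : 0 <= a -> a < b -> b <= 1 ->
  `|y - 2 * e%:~R| <= 1 ->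
  fold_ramp a b y = 2 * e%:~R + odd_ramp a b (y - 2 * e%:~R).
Proof.
move=> a0 ab b1.
move=> ye; rewrite /fold_ramp; move: (even_part y) (even_partP y) => f yf.
have : (e == f) || (e == f + 1) || (f == e + 1).
  have h1 : e%:~R < (f + 2)%:~R :> R by move: ye yf; rewrite intrD !ler_norml; lra.
  have h2 : f%:~R < (e + 2)%:~R :> R by move: ye yf; rewrite intrD !ler_norml; lra.
  by move: h1 h2; rewrite !ltr_int; lia.
have H1 : odd_ramp a b 1 = 1 by apply: odd_ramp1.
have HN1 : odd_ramp a b (-1) = -1 by rewrite odd_rampN H1.
move=> /orP[/orP[/eqP->//|/eqP eE]|/eqP eE]; move: ye yf; rewrite eE intrD => ye yf.
  have -> : y - 2 * f%:~R = 1 by move: ye yf; rewrite !ler_norml; lra.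
  have -> : y - 2 * (f%:~R + 1) = -1 by move: ye yf; rewrite !ler_norml; lra.
  by rewrite H1 HN1; lra.
have -> : y - 2 * e%:~R = 1 by move: ye yf; rewrite !ler_norml; lra.
have -> : y - 2 * (e%:~R + 1) = -1 by move: ye yf; rewrite !ler_norml; lra.
by rewrite H1 HN1; lra.
Qed.

Lemma fold_ramp_refl a b (k : int) y : 0 <= a -> a < b -> b <= 1 ->
  fold_ramp a b (2 * k%:~R - y) = 2 * k%:~R - fold_ramp a b y.
Proof.
move=> a0 ab b1.
rewrite (@fold_rampE _ _ _ (k - even_part y))//; last first.
  have := even_partP y; rewrite -normrN intrB; congr (`|_| <= _); lra.
rewrite /fold_ramp intrB.
have -> : 2 * k%:~R - y - 2 * (k%:~R - (even_part y)%:~R) =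
  - (y - 2 * (even_part y)%:~R) by lra.
by rewrite odd_rampN; lra.
Qed.

(** Around one even integer this is the bound for [odd_ramp]. Points with different centres are
    compared through the odd integers [2 * e + 1] and [2 * f - 1] between them, which are fixed. *)
Lemma fold_ramp_lip a b y z : 0 <= a -> a < b -> b <= 1 ->
  y <= z ->
  0 <= fold_ramp a b z - fold_ramp a b y <= 2 / (b - a) * (z - y).
Proof.
move=> a0 ab b1 yz; rewrite /fold_ramp.
move: (even_part y) (even_partP y) (even_part z) (even_partP z) => e ye f zf.
have C1 : 2 <= 2 / (b - a) by rewrite ler_pdivlMr ?subr_gt0//; lra.
have H1 : odd_ramp a b 1 = 1 by apply: odd_ramp1.
have HN1 : odd_ramp a b (-1) = -1 by rewrite odd_rampN H1.
have [fe|fe|->] := ltrgtP f e.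
- have : (f + 1)%:~R <= e%:~R :> R by rewrite ler_int; lia.
  rewrite intrD => fe1.
  have -> : y - 2 * e%:~R = -1 by move: ye zf; rewrite !ler_norml; lra.
  have -> : z - 2 * f%:~R = 1 by move: ye zf; rewrite !ler_norml; lra.
  rewrite H1 HN1.
  have -> : e%:~R = f%:~R + 1 :> R by move: ye zf; rewrite !ler_norml; lra.
  have -> : z = y by move: ye zf; rewrite !ler_norml; lra.
  by rewrite subrr mulr0; lra.
- have : (e + 1)%:~R <= f%:~R :> R by rewrite ler_int; lia.
  rewrite intrD => fe1; move: ye zf; rewrite !ler_norml => /andP[y1 y2] /andP[z1 z2].
  have := odd_ramp_lip ab y2; rewrite H1 => /andP[h1 h2].
  have := odd_ramp_lip ab z1; rewrite HN1 => /andP[h3 h4].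
  apply/andP; split; first lra.
  have : 2 * (2 * f%:~R - 2 * e%:~R - 2) <= 2 / (b - a) * (2 * f%:~R - 2 * e%:~R - 2).
    by rewrite ler_wpM2r//; lra.
  move: h2 h4; move: (2 / (b - a)) => C; lra.
- have yz' : y - 2 * e%:~R <= z - 2 * e%:~R by lra.
  have /andP[h1 h2] := odd_ramp_lip ab yz'; apply/andP; split; first lra.
  by move: h2; move: (2 / (b - a)) => C; lra.
Qed.

Lemma fold_ramp_near a b y : 0 <= a -> a < b -> b <= 1 ->
  `|fold_ramp a b y - y| <= 2.
Proof.
move=> a0 ab b1; rewrite /fold_ramp; move: (even_part y) (even_partP y) => e.
have H1 : odd_ramp a b 1 = 1 by apply: odd_ramp1.
have HN1 : odd_ramp a b (-1) = -1 by rewrite odd_rampN H1.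
rewrite !ler_norml => /andP[y1 y2].
have /andP[+ _] := odd_ramp_lip ab y2; have /andP[+ _] := odd_ramp_lip ab y1.
rewrite H1 HN1; lra.
Qed.

(** The weights cancel the denominators of the ramps. The remaining differences of minima telescope
    from threshold 0 to threshold 1, and leave the offset of [y] from its even centre because that
    offset has absolute value at most 1. *)
Lemma sum_fold_ramp (c : nat -> R) k y : c 0%N = 0 -> c k = 1 ->
  (forall i, (i < k)%N -> c i < c i.+1) ->
  \sum_(i < k) (c i.+1 - c i) * fold_ramp (c i) (c i.+1) y = y.
Proof.
move=> c0 ck cS; rewrite /fold_ramp; move: (even_part y) (even_partP y) => e ye.
under eq_bigr do rewrite mulrDr.
rewrite big_split/= -mulr_suml.
have teleS (f : nat -> R) : \sum_(i < k) (f i.+1 - f i) = f k - f 0%N.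
  by rewrite -(big_mkord xpredT (fun i => f i.+1 - f i)) telescope_sumr.
rewrite teleS ck c0 subr0 mul1r.
rewrite (eq_bigr (fun i : 'I_k =>
  (Num.min (y - 2 * e%:~R) (c i.+1) - Num.min (- (y - 2 * e%:~R)) (c i.+1)) -
  (Num.min (y - 2 * e%:~R) (c i) - Num.min (- (y - 2 * e%:~R)) (c i)))).
  rewrite (teleS (fun i => Num.min (y - 2 * e%:~R) (c i) -
    Num.min (- (y - 2 * e%:~R)) (c i))) ck c0.
  rewrite [RHS](_ : y = 2 * e%:~R + (y - 2 * e%:~R)); last lra.
  move: ye; rewrite ler_norml; move: (y - _) => z.
  by case: (leP z 1); case: (leP (- z) 1); case: (leP z 0); case: (leP (- z) 0); lra.
move=> i _; have := cS _ (ltn_ord i); rewrite -subr_gt0 => ci.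
by rewrite /odd_ramp /ramp -mulrBl mulrC mulfVK ?gt_eqF//; lra.
Qed.

End Ramps.

(** * Graph distance and injective hull *)

Section GraphDistance.
Variables (X : Type) (e : rel X).

Lemma has_walk0 x : has_walk e x x 0.
Proof. by exists [::]. Qed.

Lemma has_walk_cat x y z m n :
  has_walk e x y m -> has_walk e y z n -> has_walk e x z (m + n).
Proof.
move=> [s [xs sy sm]] [u [yu uz un]]; exists (s ++ u); split.
- by rewrite cat_path xs sy yu.
- by rewrite last_cat sy.
- by rewrite size_cat sm un.
Qed.

Lemma has_walk1 x y : e x y -> has_walk e x y 1.
Proof. by move=> xy; exists [:: y]; rewrite /= xy. Qed.

Lemma has_walk_sym x y n : symmetric e -> has_walk e x y n -> has_walk e y x n.
Proof.
move=> es [s]; elim: s x n => [|z s IH] x n [/= xs sy sn].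
  by rewrite -sn sy; apply: has_walk0.
move: xs => /andP[xz zs]; rewrite -sn -addn1.
apply: has_walk_cat (IH z _ _) _; last by apply: has_walk1; rewrite es.
by split.
Qed.

Lemma gdistE x y n : has_walk e x y n ->
  (forall m, has_walk e x y m -> (n <= m)%N) -> gdist e x y = n.
Proof.
move=> xyn nmin; rewrite /gdist; case: xgetP => [m _ [xym mmin]|/(_ n)[]//].
by apply/eqP; rewrite eqn_leq mmin//= nmin.
Qed.

Hypothesis cG : connected_graph e.

Lemma gdistP x y : has_walk e x y (gdist e x y) /\
  forall m, has_walk e x y m -> (gdist e x y <= m)%N.
Proof.
have [_ _ _ /(_ x y) xy] := cG.
have xyb : exists n, `[< has_walk e x y n >].
  by have [n xyn] := xy; exists n; apply/asboolP.
case: (ex_minnP xyb) => n /asboolP xyn nmin.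
have nle m : has_walk e x y m -> (n <= m)%N by move=> xym; apply/nmin/asboolP.
by rewrite (gdistE xyn nle).
Qed.

Lemma gdistxx x : gdist e x x = 0%N.
Proof. by rewrite (gdistE (has_walk0 x)). Qed.

Lemma gdistC x y : gdist e x y = gdist e y x.
Proof.
have [es _ _ _] := cG; have [xy xym] := gdistP x y; have [yx yxm] := gdistP y x.
by apply/eqP; rewrite eqn_leq xym ?yxm//; apply: has_walk_sym.
Qed.

Lemma gdist_triangle x y z : (gdist e x z <= gdist e x y + gdist e y z)%N.
Proof.
apply: (gdistP x z).2.
exact: has_walk_cat (gdistP x y).1 (gdistP y z).1.
Qed.

End GraphDistance.

Section Hull.
Variables (R : realType) (X : Type) (x0 : X) (d : X -> X -> R).
Hypotheses (dxx : forall x, d x x = 0) (dC : forall x y, d x y = d y x)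
  (d_triangle : forall x y z, d x z <= d x y + d y z).
Implicit Types (f g : X -> R).

Let D f g : R := supdist f g.

Lemma Delta_ge0 f x : Delta d f -> 0 <= f x.
Proof. by move=> /(_ x x); rewrite dxx -mulr2n pmulrn_lge0. Qed.

(** The supremum condition in terms of approximate partners [y] of [x]. The point [x0] keeps the set
    under [sup] nonempty. *)
Lemma hullP f : hull d f <-> Delta d f /\
  forall x (eps : R), 0 < eps -> exists y, f x + f y < d x y + eps.
Proof.
have supE x : [set d x y - f y | y in [set: X]] !=set0 by exists (d x x0 - f x0), x0.
have ubE x : Delta d f -> ubound [set d x y - f y | y in [set: X]] (f x).
  by move=> Df _ [y _ <-]; rewrite lerBlDr.
split=> -[Df Ef]; split=> // x.
  move=> eps eps0.
  have hs : has_sup [set d x y - f y | y in [set: X]].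
    by split=> //; exists (f x); apply: ubE.
  have [_ [y _ <-]] := sup_adherent eps0 hs.
  by rewrite -Ef => ?; exists y; lra.
apply/eqP; rewrite eq_le ge_sup ?andbT//; last exact: ubE.
apply/ler_addgt0Pr => eps /(Ef x)[y xy].
have : d x y - f y <= sup [set d x y - f y | y in [set: X]].
  by apply: ub_le_sup; [exists (f x); apply: ubE | exists y].
by move: (sup _) => s; lra.
Qed.

Lemma hull_Delta f : hull d f -> Delta d f. Proof. by case. Qed.

Lemma hull_ge0 f x : hull d f -> 0 <= f x.
Proof. by move=> [Df _]; apply: Delta_ge0. Qed.

Lemma hull_le f x y : hull d f -> f x <= d x y + f y.
Proof.
move=> /hullP[Df Ef]; apply/ler_addgt0Pr => eps /(Ef x)[z xz].
by have := Df y z; have := d_triangle x y z; lra.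
Qed.

Lemma hull_embed x : hull d (embed d x).
Proof.
apply/hullP; split=> [y z|y eps eps0]; rewrite /embed; first by rewrite (dC x).
by exists x; rewrite dxx addr0 dC ltrDl.
Qed.

Lemma hull_bounded f g x : hull d f -> hull d g -> `|f x - g x| <= f x0 + g x0.
Proof.
move=> Ef Eg; have := hull_le x x0 Ef; have := hull_le x x0 Eg.
have := hull_Delta Ef x x0; have := hull_Delta Eg x x0.
by rewrite ler_norml; lra.
Qed.

Lemma supdist_ge f g x : hull d f -> hull d g -> `|f x - g x| <= D f g.
Proof.
move=> Ef Eg; apply: ub_le_sup; last by exists x.
by exists (f x0 + g x0) => _ [y _ <-]; apply: hull_bounded.
Qed.

Lemma supdist_le f g (r : R) : (forall x, `|f x - g x| <= r) -> D f g <= r.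
Proof.
by move=> fg; apply: ge_sup; [exists `|f x0 - g x0|, x0 | move=> _ [x _ <-]].
Qed.

Lemma supdist_ge0 f g : hull d f -> hull d g -> 0 <= D f g.
Proof. by move=> Ef Eg; apply: le_trans (supdist_ge x0 Ef Eg). Qed.

Lemma supdistxx f : D f f = 0.
Proof.
rewrite /D /supdist (_ : [set _ | x in _] = [set 0]) ?sup1//.
by apply/seteqP; split=> [_ [x _ <-]|_ ->]; [|exists x0]; rewrite ?subrr ?normr0.
Qed.

Lemma supdistC f g : D f g = D g f.
Proof. by rewrite /D /supdist; under eq_imagel do rewrite distrC. Qed.

Lemma supdist_triangle f g h : hull d f -> hull d g -> hull d h ->
  D f h <= D f g + D g h.
Proof.
move=> Ef Eg Eh; apply: supdist_le => x; rewrite -[f x](subrK (g x)) -addrA.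
by apply: (le_trans (ler_normD _ _)); rewrite lerD// supdist_ge.
Qed.

Lemma supdist_eq0 f g : hull d f -> hull d g -> D f g = 0 -> f = g.
Proof.
move=> Ef Eg fg0; apply/funext => x; apply/eqP; rewrite -subr_eq0 -normr_le0.
by rewrite -fg0 supdist_ge.
Qed.

Lemma supdist_embed f x : hull d f -> D f (embed d x) = f x.
Proof.
move=> Ef; apply/eqP; rewrite eq_le; apply/andP; split.
  apply: supdist_le => y; rewrite /embed ler_norml.
  have := hull_Delta Ef x y; have := hull_le y x Ef; rewrite (dC y); lra.
apply: le_trans (supdist_ge x Ef (hull_embed x)).
by rewrite /embed dxx subr0 ler_norm.
Qed.

Lemma supdist_embed_embed x y : D (embed d x) (embed d y) = d x y.
Proof. by rewrite supdist_embed//; apply: hull_embed. Qed.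

End Hull.

(** * Lattice points *)

(** A minimal admissible function below [g] is extremal: if no [y] were tight for [x], its value at
    [x] could be lowered by 1. For natural numbers the infimum of a chain is attained at each point,
    so Zorn's lemma applies. *)
Lemma nat_extremal (X : Type) (m : X -> X -> nat) (g : X -> nat) :
  (forall x, m x x = 0%N) -> (forall x y, m x y = m y x) ->
  (forall x y, 2 * m x y <= g x + g y)%N ->
  exists f : X -> nat, [/\ forall x, (f x <= g x)%N,
    forall x y, (2 * m x y <= f x + f y)%N
    & forall x, exists y, (f x + f y = 2 * m x y)%N].
Proof.
move=> mxx mC Dg.
pose ok (f : X -> nat) := (forall x, (f x <= g x)%N) /\
  forall x y, (2 * m x y <= f x + f y)%N.
pose T := {f | ok f}; have okg : ok g by split.
(* The order is reversed, so a maximal element is a pointwise minimal function. *)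
pose below (f h : T) := `[< forall x, (sval h x <= sval f x)%N >].
have [||A chA|t tmax] := @ZL_preorder T (exist _ g okg) below.
- by move=> f; apply/asboolP.
- move=> f h k /asboolP fh /asboolP hk; apply/asboolP => x.
  exact: leq_trans (hk x) (fh x).
- have [[f0 Af0]|A0] := pselect (exists f, A f); last first.
    by exists (exist _ g okg) => f Af; case: A0; exists f.
  have exA x : exists n, `[< exists2 f, A f & n = sval f x >].
    by exists (sval f0 x); apply/asboolP; exists f0.
  pose h x := ex_minn (exA x).
  have hP x : exists2 f, A f & h x = sval f x.
    by rewrite /h; case: ex_minnP => n /asboolP[f Af ->] _; exists f.
  have hle f x : A f -> (h x <= sval f x)%N.
    move=> Af; rewrite /h; case: ex_minnP => n _; apply.
    by apply/asboolP; exists f.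
  have okh : ok h.
    split=> [x|x y].
      have [f _ ->] := hP x; exact: (svalP f).1.
    (* The values of [h] at [x] and [y] may come from two members of the chain; the smaller member
       bounds both from below. *)
    have [f1 A1 E1] := hP x; have [f2 A2 E2] := hP y.
    have [/asboolP le|/asboolP le] := chA _ _ A1 A2.
      apply: leq_trans ((svalP f2).2 x y) _; rewrite E2 leq_add2r E1.
      exact: le.
    apply: leq_trans ((svalP f1).2 x y) _; rewrite E1 leq_add2l E2.
    exact: le.
  by exists (exist _ h okh) => f Af; apply/asboolP => x; apply: hle.
case: t tmax => f [fg Df] tmax; exists f; split=> // x.
apply: contrapT => Nx.
have lt y : (2 * m x y < f x + f y)%N.
  rewrite ltn_neqAle Df andbT; apply/eqP => E; apply: Nx; exists y.
  exact/esym.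
pose f' y := if `[< y = x >] then (f x).-1 else f y.
have okf' : ok f'.
  split=> [y|y z]; rewrite /f'.
    by case: asboolP => [->|_]; rewrite // (leq_trans (leq_pred _)).
  case: asboolP => [->|_]; case: asboolP => [->|_] //.
  - by rewrite mxx muln0.
  - by have := lt z; lia.
  - by have := lt y; rewrite mC; lia.
have /tmax /asboolP/(_ x)/= : below (exist _ f (conj fg Df)) (exist _ f' okf').
  by apply/asboolP => y /=; rewrite /f'; case: asboolP => [->|//]; exact: leq_pred.
by rewrite /f'; case: asboolP => // _; have := lt x; rewrite mxx; lia.
Qed.

(** An element within [l] of the supremum is the supremum: a larger element would exceed it by at
    least [l]. *)
Lemma sup_multiples (R : realType) (l : R) (A : set R) : 0 < l -> A !=set0 ->
  has_ubound A -> (forall a, A a -> exists k : nat, a = l * k%:R) ->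
  A (sup A).
Proof.
move=> l0 A0 ubA Al; have [a Aa supa] := sup_adherent l0 (conj A0 ubA).
suff -> : sup A = a by [].
apply/eqP; rewrite eq_le ub_le_sup// andbT; apply: ge_sup => // b Ab.
have bs : b <= sup A by exact: ub_le_sup.
move: supa; have [k ->] := Al _ Aa; have [j bE] := Al _ Ab => supa.
have : l * j%:R < l * (k.+1)%:R.
  by rewrite -bE -natr1 mulrDr mulr1; move: supa bs; move: (sup A) => s; lra.
by rewrite bE ltr_pM2l// ltr_nat ltnS ler_pM2l// ler_nat.
Qed.

Section LatticePoints.
Variables (R : realType) (X : Type) (x0 : X) (m : X -> X -> nat) (l : R).
Hypotheses (l0 : 0 < l) (mxx : forall x, m x x = 0%N)
  (mC : forall x y, m x y = m y x)
  (m_triangle : forall x y z, (m x z <= m x y + m y z)%N).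

Let d x y : R := l * (2 * m x y)%:R.

Let dxx x : d x x = 0. Proof. by rewrite /d mxx muln0 mulr0. Qed.
Let dC x y : d x y = d y x. Proof. by rewrite /d mC. Qed.
Let d_triangle x y z : d x z <= d x y + d y z.
Proof.
by rewrite /d -mulrDr ler_pM2l// -natrD ler_nat -mulnDr leq_mul2l m_triangle.
Qed.

Let D : (X -> R) -> (X -> R) -> R := @supdist R X.

Definition lattice_points : set (X -> R) :=
  [set p | hull d p /\ forall x, exists k : nat, p x = l * k%:R].

Local Notation V := lattice_points.

Lemma lattice_points_hull p : V p -> hull d p. Proof. by case. Qed.

Lemma lattice_pointsI (f : X -> nat) :
  (forall x y, 2 * m x y <= f x + f y)%N ->
  (forall x, exists y, f x + f y = 2 * m x y)%N -> V (fun x => l * (f x)%:R).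
Proof.
move=> Df Ef; split=> [|x]; last by exists (f x).
apply/(hullP x0); split=> [x y|x eps eps0].
  by rewrite -mulrDr ler_pM2l// -natrD ler_nat.
have [y xy] := Ef x; exists y.
by rewrite /d -xy -mulrDr -natrD ltrDl.
Qed.

Lemma lattice_points_embed x : V (embed d x).
Proof. by split=> [|y]; [exact: hull_embed | exists (2 * m x y)%N]. Qed.

Lemma lattice_points_dist p q : V p -> V q -> exists n : nat, D p q = l * n%:R.
Proof.
move=> [Ep Vp] [Eq Vq].
have VB x : exists k : nat, `|p x - q x| = l * k%:R.
  have [i ->] := Vp x; have [j ->] := Vq x; rewrite -mulrBr normrM gtr0_norm//.
  exists `|(i : int) - (j : int)|%N; congr (_ * _).
  by rewrite natr_absz intr_norm intrB.
have [|||x _ xE] := @sup_multiples R l [set `|p x - q x| | x in [set: X]] l0.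
- by exists `|p x0 - q x0|, x0.
- by exists (p x0 + q x0) => _ [x _ <-]; apply: (hull_bounded x0 d_triangle).
- by move=> _ [x _ <-].
by have [n nE] := VB x; exists n; rewrite /D /supdist -xE.
Qed.

(** Hyperconvexity at scale [l]. An extremal integer function below the least of the bounds
    [p + l * r] satisfies every upper bound. The lower bounds follow: for a near partner [y] of [x]
    with respect to [p], the upper bound at [y] becomes a lower bound at [x]. *)
Lemma lattice_points_hyperconvex (F : set ((X -> R) * nat)) : F !=set0 ->
  (forall b, F b -> V b.1) ->
  (forall b c, F b -> F c -> D b.1 c.1 <= l * (b.2 + c.2)%:R) ->
  exists2 w, V w & forall b, F b -> D b.1 w <= l * b.2%:R.
Proof.
move=> [b0 Fb0] FV FD.
have exF x : exists n : nat, `[< exists2 b, F b & l * n%:R = b.1 x + l * b.2%:R >].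
  have [k kE] := (FV _ Fb0).2 x; exists (k + b0.2)%N; apply/asboolP; exists b0 => //.
  by rewrite kE natrD mulrDr.
pose g x := ex_minn (exF x).
have gP x : exists2 b, F b & l * (g x)%:R = b.1 x + l * b.2%:R.
  by rewrite /g; case: ex_minnP => n /asboolP.
have gle b x : F b -> l * (g x)%:R <= b.1 x + l * b.2%:R.
  move=> Fb; have [k kE] := (FV _ Fb).2 x; rewrite /g; case: ex_minnP => n _ nmin.
  rewrite kE -mulrDr ler_pM2l// -natrD ler_nat; apply: nmin; apply/asboolP.
  by exists b => //; rewrite kE natrD mulrDr.
have Dg x y : (2 * m x y <= g x + g y)%N.
  have [b Fb bE] := gP x; have [c Fc cE] := gP y.
  rewrite -(ler_nat R) -(ler_pM2l l0) natrD mulrDr bE cE.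
  have [Eb _] := FV _ Fb; have [Ec _] := FV _ Fc.
  have := hull_Delta Eb x y; have := supdist_ge x0 d_triangle y Eb Ec.
  have := FD _ _ Fb Fc; rewrite -/D natrD mulrDr => h1 h2.
  have := le_trans h2 h1; rewrite ler_norml -/(d x y) => /andP[]; lra.
have [f [fg Df Ef]] := nat_extremal mxx mC Dg.
have Vf := lattice_pointsI Df Ef; exists (fun x => l * (f x)%:R) => // b Fb.
have fb x : l * (f x)%:R <= b.1 x + l * b.2%:R.
  by apply: le_trans (gle _ _ Fb); rewrite ler_pM2l// ler_nat.
apply: (supdist_le x0) => x; rewrite ler_norml; apply/andP; split.
  by have := fb x; lra.
have [Eb _] := FV _ Fb; have /(hullP x0)[_ Eb'] := Eb.
suff : b.1 x <= l * (f x)%:R + l * b.2%:R by lra.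
apply/ler_addgt0Pr => eps /(Eb' x)[y xy].
have := fb y; have := hull_Delta (lattice_points_hull Vf) x y; lra.
Qed.

(** Take a common point of the balls of radii 1 and [n]; the triangle inequality turns both bounds
    into equalities. *)
Lemma lattice_points_between p q n : V p -> V q -> D p q = l * n.+1%:R ->
  exists2 w, V w & D p w = l /\ D w q = l * n%:R.
Proof.
move=> Vp Vq pq; have [Ep _] := Vp; have [Eq _] := Vq.
have Dpp f : D f f = 0 by rewrite /D (supdistxx x0).
have [|||w Vw wF] :=
    @lattice_points_hyperconvex [set b | b = (p, 1%N) \/ b = (q, n)].
- by exists (p, 1%N); left.
- by move=> b [->|->].
- move=> b c [->|->] [->|->] /=; rewrite ?Dpp ?mulr_ge0 ?(ltW l0)//.
    by rewrite pq add1n.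
  by rewrite /D supdistC -/D pq addn1.
exists w => //; have [Ew _] := Vw.
have /= pw := wF _ (or_introl erefl); have /= qw := wF _ (or_intror erefl).
rewrite /D supdistC -/D in qw.
have := supdist_triangle x0 d_triangle Ep Ew Eq; rewrite -/D pq.
by move: pw qw; rewrite -natr1 mulrDr mulr1 => pw qw h; split; lra.
Qed.

Let eV := edge_rel D l (V := V).

Lemma edge_walk_le (p q : V) n : has_walk eV p q n -> D (val p) (val q) <= l * n%:R.
Proof.
have hV (w : V) : hull d (val w) by have [] := set_mem (valP w).
move=> [s]; elim: s p n => [|w s IH] p n [/= ps sq <-].
  by rewrite sq /D (supdistxx x0) mulr0.
move: ps => /andP[/eqP pw ws].
apply: (le_trans (supdist_triangle x0 d_triangle (hV p) (hV w) (hV q))).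
rewrite -natr1 mulrDr mulr1 addrC lerD//; last by rewrite -/D pw.
exact: IH.
Qed.

Lemma edge_walk n (p q : V) : D (val p) (val q) = l * n%:R -> has_walk eV p q n.
Proof.
have hV (w : V) : V (val w) by apply: set_mem (valP w).
elim: n p => [|n IH] p pq.
  suff -> : p = q by apply: has_walk0.
  apply: val_inj; apply: (supdist_eq0 x0 d_triangle) => //;
    try exact: lattice_points_hull.
  by rewrite -/D pq mulr0.
have [w Vw [pw wq]] := lattice_points_between (hV p) (hV q) pq.
rewrite -[n.+1]add1n; apply: (@has_walk_cat _ _ _ (SigSub (mem_set Vw))).
  by apply: has_walk1; apply/eqP.
exact: IH.
Qed.

Lemma edge_gdist (p q : V) : D (val p) (val q) = l * (gdist eV p q)%:R.
Proof.
have hV (w : V) : V (val w) by apply: set_mem (valP w).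
have [n pq] := lattice_points_dist (hV p) (hV q).
rewrite (@gdistE _ _ _ _ n)//; first exact: edge_walk.
by move=> k /edge_walk_le; rewrite pq ler_pM2l// ler_nat.
Qed.

Lemma lattice_points_Helly : Helly_graph eV.
Proof.
have hV (w : V) : V (val w) by apply: set_mem (valP w).
have ballE (p q : V) r : gball eV p r q <-> D (val p) (val q) <= l * r%:R.
  by rewrite edge_gdist /gball/= ler_pM2l// ler_nat.
split; first split.
- by move=> p q; rewrite /eV/edge_rel /D supdistC.
- by move=> p; rewrite /eV/edge_rel /D (supdistxx x0) lt_eqF.
- by exists (SigSub (mem_set (lattice_points_embed x0))).
- move=> p q; have [n pq] := lattice_points_dist (hV p) (hV q).
  by exists n; apply: edge_walk.
move=> F Fint; have [[b0 Fb0]|F0] := pselect (F !=set0); last first.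
  by exists (SigSub (mem_set (lattice_points_embed x0))) => b Fb; case: F0; exists b.
have [|||w Vw wF] := @lattice_points_hyperconvex
    [set (val b.1, b.2) | b in F].
- by exists (val b0.1, b0.2), b0.
- by move=> _ [b _ <-]; apply: hV.
- move=> _ _ [b Fb <-] [c Fc <-] /=; have [w [/ballE bw /ballE cw]] := Fint _ _ Fb Fc.
  apply: (le_trans (supdist_triangle x0 d_triangle (hV _).1 (hV w).1 (hV _).1)).
  by rewrite natrD mulrDr lerD// supdistC.
exists (SigSub (mem_set Vw)) => b Fb; apply/ballE.
exact: (wF (val b.1, b.2) (ex_intro2 _ _ b Fb erefl)).
Qed.

End LatticePoints.

(** * Folding the hull *)

Lemma nondecreasing_upto (R : realType) (c : nat -> R) k :
  (forall i, (i < k)%N -> c i < c i.+1) ->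
  forall i j, (i <= j)%N -> (j <= k)%N -> c i <= c j.
Proof.
move=> cS i; elim=> [|j IH]; first by rewrite leqn0 => /eqP->.
rewrite leq_eqVlt => /predU1P[->//|ij jk].
by apply: le_trans (IH ij (ltnW jk)) _; rewrite ltW// cS.
Qed.

Section Folding.
Variable R : realType.
Implicit Types (G : R -> R) (C y : R).

Definition folding C G : Prop :=
  (forall y z, y <= z -> 0 <= G z - G y <= C * (z - y)) /\
  forall (k : int) y, G (2 * k%:~R - y) = 2 * k%:~R - G y.

Lemma folding_fold_ramp (a b : R) : 0 <= a -> a < b -> b <= 1 ->
  folding (2 / (b - a)) (fold_ramp a b).
Proof.
by move=> a0 ab b1; split=> [y z|k y]; [apply: fold_ramp_lip | apply: fold_ramp_refl].
Qed.

Lemma folding_sum k (t C : 'I_k -> R) (G : 'I_k -> R -> R) :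
  convex_weights t -> (forall i, folding (C i) (G i)) ->
  folding (\sum_i t i * C i) (fun y => \sum_i t i * G i y).
Proof.
move=> [t0 t1] FG; split=> [y z yz|a y].
  rewrite -sumrB mulr_suml; apply/andP; split.
    by apply: sumr_ge0 => i _; rewrite -mulrBr mulr_ge0//; have /andP[] := (FG i).1 _ _ yz.
  apply: ler_sum => i _; rewrite -mulrBr -mulrA ler_wpM2l//.
  by have /andP[] := (FG i).1 _ _ yz.
have kE : 2 * a%:~R = \sum_i t i * (2 * a%:~R) by rewrite -mulr_suml t1 mul1r.
rewrite [X in _ = X - _]kE -sumrB; apply: eq_bigr => i _.
by rewrite (FG i).2 mulrBr.
Qed.

Lemma fold_ramp_val (a b : R) (e : int) (s u : R) : 0 <= a -> a < b -> b <= 1 ->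
  (s = 1 \/ s = -1) -> 0 <= u <= 1 -> (u <= a) || (b <= u) ->
  fold_ramp a b (2 * e%:~R + s * u) = 2 * e%:~R + s * (b <= u)%R%:R.
Proof.
move=> a0 ab b1 s1 /andP[u0 u1] au.
have dE : 2 * e%:~R + s * u - 2 * e%:~R = s * u by lra.
rewrite (@fold_rampE _ a b _ e) ?dE//; last first.
  by rewrite ler_norml; case: s1 => ->; lra.
have bu : u <= a -> (b <= u) = false.
  by move=> ua; apply/negbTE; rewrite -ltNge (le_lt_trans ua).
congr (_ + _); move/orP: au => [ua|bu'].
  rewrite bu// mulr0 odd_ramp0// ler_norml.
  by case: s1 => ->; lra.
rewrite bu' mulr1; case: s1 => ->; first by rewrite mul1r odd_ramp1.
by rewrite mulN1r odd_rampN odd_ramp1.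
Qed.

Definition fold_value y : R := `|y - 2 * (even_part y)%:~R|.

Lemma fold_valueP y : exists (e : int) (s : R),
  (s = 1 \/ s = -1) /\ y = 2 * e%:~R + s * fold_value y.
Proof.
exists (even_part y); rewrite /fold_value; move: (even_part y) => e.
have [h|h] := leP 0 (y - 2 * e%:~R).
  by exists 1; split; [left | rewrite mul1r ger0_norm; lra].
by exists (-1); split; [right | rewrite mulN1r ltr0_norm; lra].
Qed.

Lemma fold_value_itv y : 0 <= fold_value y <= 1.
Proof. by rewrite /fold_value normr_ge0 even_partP. Qed.

End Folding.

Section FoldedHull.
Variables (R : realType) (X : Type) (x0 : X) (m : X -> X -> nat) (l : R).
Hypotheses (l0 : 0 < l) (mxx : forall x, m x x = 0%N)
  (mC : forall x y, m x y = m y x)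
  (m_triangle : forall x y z, (m x z <= m x y + m y z)%N).

Let d x y : R := l * (2 * m x y)%:R.
Let d_triangle x y z : d x z <= d x y + d y z.
Proof.
by rewrite /d -mulrDr ler_pM2l// -natrD ler_nat -mulnDr leq_mul2l m_triangle.
Qed.
Let D : (X -> R) -> (X -> R) -> R := @supdist R X.

Lemma hull_folding C G f : folding C G -> hull d f ->
  hull d (fun x => l * G (f x / l)).
Proof.
move=> [Glip Grefl] /(hullP x0)[Df Ef]; apply/(hullP x0).
have dE x y : d x y / l = 2 * (m x y)%:~R.
  by rewrite /d mulrC mulKf ?gt_eqF// natrM.
split=> [x y|x eps eps0].
  have : d x y / l - f x / l <= f y / l.
    by rewrite -mulrBl ler_pM2r ?invr_gt0// lerBlDl.
  rewrite dE => /Glip/andP[+ _]; rewrite Grefl -dE subr_ge0 => h.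
  have := ler_wpM2l (ltW l0) h; rewrite mulrBr mulrCA divff ?gt_eqF// mulr1; lra.
have C0 : 0 <= C.
  by have /andP[h1 h2] := Glip 0 1 ler01; rewrite subr0 mulr1 in h2; apply: le_trans h2.
(* [C] may be 0; the extra 1 also makes the final inequality strict. *)
have C1 : 0 < C + 1 by rewrite ltr_wpDl.
have [y xy] := Ef x _ (divr_gt0 eps0 C1); exists y.
set dl := eps / (C + 1) in xy.
have dl0 : 0 < dl by rewrite divr_gt0.
have epsE : eps = dl * (C + 1) by rewrite /dl mulfVK// gt_eqF.
have fy : f y / l <= d x y / l - f x / l + dl / l.
  by rewrite -mulrBl -mulrDl ler_pM2r ?invr_gt0//; lra.
set A := d x y / l - f x / l in fy *.
have Adl : A <= A + dl / l by rewrite lerDl divr_ge0// ltW.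
have /andP[_] := Glip _ _ Adl; rewrite [X in C * X](_ : _ = dl / l); last lra.
have /andP[h1 _] := Glip _ _ fy.
rewrite {2}/A dE Grefl -dE => h2.
have h3 : G (f y / l) <= d x y / l - G (f x / l) + C * (dl / l) by lra.
have := ler_wpM2l (ltW l0) h3.
rewrite mulrDr mulrBr mulrCA divff ?gt_eqF// mulr1 mulrCA [l * (dl / l)]mulrCA.
by rewrite divff ?gt_eqF// mulr1 epsE; lra.
Qed.

Section Simplices.
Variables (f : X -> R) (k : nat) (c : nat -> R).

(** For thresholds increasing from 0 to 1, the gaps as weights give back [f] by [sum_fold_ramp];
    other weights stretch the gaps and spread [f] into a simplex. *)
Definition fold_simplex (t : 'I_k -> R) : X -> R :=
  fun x => l * \sum_i t i * fold_ramp (c i) (c i.+1) (f x / l).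

Hypotheses (Ef : hull d f) (c0 : forall i, 0 <= c i) (c1 : forall i, c i <= 1)
  (cS : forall i, (i < k)%N -> c i < c i.+1).

Lemma fold_simplex_hull t : convex_weights t -> hull d (fold_simplex t).
Proof.
move=> tw.
have F (i : 'I_k) := folding_fold_ramp (c0 i) (cS (ltn_ord i)) (c1 i.+1).
exact: hull_folding (folding_sum tw F) Ef.
Qed.

Lemma fold_simplex_dist t u : convex_weights t -> convex_weights u ->
  D (fold_simplex t) (fold_simplex u) <= l * (2 * \sum_i `|t i - u i|).
Proof.
move=> [_ t1] [_ u1]; apply: (supdist_le x0) => x.
rewrite -mulrBr normrM gtr0_norm// ler_pM2l// -sumrB.
have sum0 : \sum_i (t i - u i) = 0 by rewrite sumrB t1 u1 subrr.
(* As [t - u] has sum 0, [f x / l] may be subtracted in each term, which leaves factors bounded by 2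
   uniformly in [x]. *)
have -> : \sum_i (t i * fold_ramp (c i) (c i.+1) (f x / l) -
     u i * fold_ramp (c i) (c i.+1) (f x / l)) =
   \sum_i (t i - u i) * (fold_ramp (c i) (c i.+1) (f x / l) - f x / l).
  under [RHS]eq_bigr do rewrite mulrBr.
  rewrite [RHS]sumrB -[X in _ = _ - X]mulr_suml sum0 mul0r subr0.
  by apply: eq_bigr => i _; rewrite mulrBl.
rewrite mulr_sumr; apply: (le_trans (ler_norm_sum _ _ _)); apply: ler_sum => i _.
by rewrite normrM mulrC ler_wpM2r// fold_ramp_near//; apply: cS.
Qed.

(** Cumulative weights can be read off at single points of X: a fold value [c j] of [f] becomes the
    sum of the first [j] weights. *)
Lemma fold_simplex_val t x (e : int) (s : R) j : convex_weights t ->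
  s = 1 \/ s = -1 -> f x / l = 2 * e%:~R + s * c j -> (j <= k)%N ->
  fold_simplex t x / l = 2 * e%:~R + s * \sum_(i < k | (i < j)%N) t i.
Proof.
move=> [t0 t1] s1 fx jk; rewrite /fold_simplex mulrC mulKf ?gt_eqF//.
have cle i : (i <= k)%N -> forall i', (i' <= i)%N -> c i' <= c i.
  by move=> ik i' ii'; apply: nondecreasing_upto cS _ _ ii' ik.
have eE : 2 * e%:~R = \sum_i t i * (2 * e%:~R) by rewrite -mulr_suml t1 mul1r.
rewrite [X in _ = X + _]eE [in RHS]mulr_sumr [in X in _ + X]big_mkcond.
rewrite -big_split/=; apply: eq_bigr => i _; rewrite fx.
have [ij|ji] := ltnP i j.
  have cij : c i.+1 <= c j by apply: cle.
  by rewrite fold_ramp_val ?cS ?c0 ?c1 ?cij ?orbT//= mulr1; lra.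
have cij : c j <= c i by apply: cle => //; apply: ltnW.
rewrite fold_ramp_val ?cS ?c0 ?c1 ?cij//.
have -> : (c i.+1 <= c j) = false.
  by apply/negbTE; rewrite -ltNge (le_lt_trans cij)// cS.
by rewrite mulr0; lra.
Qed.

End Simplices.
End FoldedHull.

(** * Finiteness of fold values *)

Section Thresholds.
Variables (R : realType) (s : seq R).

(** The list framed by 0 in front and, through the default value of [nth], by 1 at the end. *)
Definition threshold (i : nat) : R := nth 1 (0 :: s) i.

Hypotheses (s_sorted : sorted <%R s) (s01 : forall a, a \in s -> 0 < a < 1).

Lemma threshold_last : threshold (size s).+1 = 1.
Proof. by rewrite /threshold nth_default. Qed.

Lemma threshold_mem i : (0 < i <= size s)%N -> threshold i \in s.
Proof. by case: i => // i is_; apply: mem_nth. Qed.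

Lemma threshold_itv i : 0 <= threshold i <= 1.
Proof.
case: i => [|i]; first by rewrite lexx ler01.
rewrite /threshold/=; have [si|/(mem_nth 1)/s01/andP[a0 a1]] := leqP (size s) i.
  by rewrite nth_default// ler01 lexx.
by rewrite !ltW.
Qed.

Lemma threshold_lt i : (i < (size s).+1)%N -> threshold i < threshold i.+1.
Proof.
rewrite ltnS leq_eqVlt => /predU1P[->|si].
  rewrite threshold_last; case: (posnP (size s)) => [->|s0]; first exact: ltr01.
  have /s01/andP[_] : threshold (size s) \in s by rewrite threshold_mem// s0 leqnn.
  by [].
case: i si => [|i] si.
  by have /s01/andP[] : threshold 1 \in s by rewrite threshold_mem.
rewrite /threshold/=.
by apply: (sorted_ltn_nth lt_trans _ s_sorted) => //; rewrite inE// ltnW.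
Qed.

Lemma threshold_index a : a \in s -> exists2 j, (j <= size s)%N & a = threshold j.
Proof.
by move=> as_; exists (index a s).+1; rewrite ?index_mem// /threshold/= nth_index.
Qed.

End Thresholds.

Lemma finite_fold_values (R : realType) (X : Type) (x0 : X) (m : X -> X -> nat)
    (l : R) (n : nat) (f : X -> R) :
  0 < l -> (forall x y z, (m x z <= m x y + m y z)%N) ->
  let d x y := l * (2 * m x y)%:R in
  covering_dim_le (@supdist R X) (hull d) n -> hull d f ->
  finite_set [set fold_value (f x / l) | x in [set: X]].
Proof.
move=> l0 m_triangle d Hdim Ef; apply: contrapT => infA.
have d_triangle x y z : d x z <= d x y + d y z.
  by rewrite /d -mulrDr ler_pM2l// -natrD ler_nat -mulnDr leq_mul2l m_triangle.
set A := (X in ~ finite_set X) in infA.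
have infA' : infinite_set (A `\` [set 0; 1]).
  by apply: infinite_setD => //; exact: finite_set2.
have [B BA nB] := infinite_set_fset n.+1 infA'.
pose s := take n.+1 (sort <=%R (finmap.enum_fset B)).
have ss : size s = n.+1 by rewrite size_takel// size_sort.
have sA a : a \in s -> A a /\ 0 < a < 1.
  move=> /mem_take; rewrite mem_sort => /BA [Aa /not_orP[a0 a1]]; split=> //.
  case: Aa a0 a1 => x _ <- a0 a1; have /andP[b0 b1] := fold_value_itv (f x / l).
  by rewrite !lt_neqAle b0 b1 !andbT eq_sym; apply/andP; split; apply/eqP.
have s_sorted : sorted <%R s.
  rewrite lt_sorted_uniq_le; apply/andP; split.
    by apply: take_uniq; rewrite sort_uniq; exact: finmap.fset_uniq.
  by apply: take_sorted; exact: sort_le_sorted.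
have s01 a : a \in s -> 0 < a < 1 by move=> /sA[].
(* The [n.+1] interior thresholds cut [0, 1] into [n.+2] gaps, which become the vertices of a
   simplex of dimension [n.+1]. *)
pose c := threshold s; pose k := n.+2.
have cS i : (i < k)%N -> c i < c i.+1 by rewrite /k -ss; apply: threshold_lt.
have c0 i : 0 <= c i by have /andP[] := threshold_itv s01 i.
have c1 i : c i <= 1 by have /andP[] := threshold_itv s01 i.
have ck : c k = 1 by rewrite /c /k -ss threshold_last.
(* For each interior threshold, a point where [f] has that fold value, with its even centre and its
   side; the other indices get junk. *)
have exx j : exists xes : X * int * R, (xes.2 = 1 \/ xes.2 = -1) /\
    ((0 < j < k)%N -> f xes.1.1 / l = 2 * xes.1.2%:~R + xes.2 * c j).
  have [jk|jk] := boolP (0 < j < k)%N; last by exists (x0, 0, 1); split=> //; left.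
  have /sA[[x _ xc] _] : c j \in s.
    by apply: threshold_mem; rewrite ss -ltnS.
  have [e [sg [sg1 fxE]]] := fold_valueP (f x / l).
  by exists (x, e, sg); split=> //= _; rewrite fxE xc.
have {exx}/choice[xes xesP] := exx.
pose x j := (xes j).1.1; pose e j := (xes j).1.2; pose sg j := (xes j).2.
have sg1 j : sg j = 1 \/ sg j = -1 by case: (xesP j).
have fxE j : (0 < j < k)%N -> f (x j) / l = 2 * (e j)%:~R + sg j * c j.
  by case: (xesP j).
(* On the simplex this is the weight of the first [j] vertices. Setting it to 0 and 1 at the two
   ends on the whole hull makes the differences [bar] sum to 1 everywhere, so that the sets [U i]
   below cover the hull and not just the simplex. *)
pose coord j (q : X -> R) : R :=
  if j == 0%N then 0 else if j == k then 1 else sg j * (q (x j) / l - 2 * (e j)%:~R).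
pose bar (i : 'I_k) q := coord i.+1 q - coord i q.
pose psi (t : 'rV[R]_k) := fold_simplex l f c (fun i : 'I_k => t 0 i).
have simplexP (t : 'rV[R]_k) : std_simplex t -> convex_weights (fun i => t 0 i) by [].
have psiE t : std_simplex t -> hull d (psi t).
  by move=> /simplexP; apply: fold_simplex_hull.
have coord_psi t j : std_simplex t -> (j <= k)%N ->
    coord j (psi t) = \sum_(i < k | (i < j)%N) t 0 i.
  move=> st jk; rewrite /coord; case: eqVneq => [->|j0]; first by rewrite big_pred0.
  case: eqVneq => [->|jk'].
    by rewrite -st.2; apply: eq_bigl => i; rewrite ltn_ord.
  have jk2 : (0 < j < k)%N by rewrite lt0n j0 ltn_neqAle jk'.
  rewrite (fold_simplex_val l0 c0 c1 cS (simplexP _ st) (sg1 j) (fxE j jk2))//.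
  rewrite addrAC subrr add0r mulrA.
  by case: (sg1 j) => ->; rewrite ?mul1r// mulrNN !mul1r.
have bar_psi t i : std_simplex t -> bar i (psi t) = t 0 i.
  move=> st; rewrite /bar !coord_psi ?ltn_ord//; last exact: ltnW.
  rewrite (bigD1 i)//= (eq_bigl (fun j : 'I_k => (j < i)%N)) ?addrK// => j.
  by rewrite ltnS ltn_neqAle andbC.
have coord_lip j p q : hull d p -> hull d q ->
    `|coord j p - coord j q| <= supdist p q / l.
  move=> Ep Eq; rewrite /coord; do 2 (case: ifP => _; first by
    rewrite subrr normr0 divr_ge0 ?(ltW l0)// (supdist_ge0 x0 d_triangle)).
  rewrite -mulrBr opprD addrACA opprK [X in _ + X]addrC subrr addr0 normrM.
  rewrite -mulrBl normrM [`|l^-1|]gtr0_norm ?invr_gt0// mulrA ler_pM2r ?invr_gt0//.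
  have -> : `|sg j| = 1 by case: (sg1 j) => ->; rewrite ?normrN normr1.
  by rewrite mul1r; apply: supdist_ge.
pose U i := [set q | hull d q /\ bar i q != 0].
have Ucov : finite_open_cover (@supdist R X) (hull d) U.
  split=> [i|q Eq].
    (* [bar i] is a difference of two functions with Lipschitz constant [1 / l]. *)
    split=> [q []//|p [Ep pi]]; exists (`|bar i p| * l / 2).
      by rewrite divr_gt0// mulr_gt0// normr_gt0.
    move=> q Eq pq; split=> //; apply: contraTneq pq => qi; rewrite -leNgt.
    rewrite -[bar i p]subr0 -qi /bar.
    have := coord_lip i.+1 _ _ Ep Eq; have := coord_lip i _ _ Ep Eq.
    rewrite ler_pdivrMr// -ler_pdivlMr// => h1 h2.
    rewrite (_ : _ - _ - _ = (coord i.+1 p - coord i.+1 q) - (coord i p - coord i q)).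
      by apply: (le_trans (ler_normB _ _)); lra.
    by lra.
  have bar1 : \sum_(i < k) bar i q = 1.
    rewrite -(big_mkord xpredT (fun i => coord i.+1 q - coord i q)) telescope_sumr//.
    by rewrite /coord/= eqxx subr0.
  apply: contrapT => Nq; suff : \sum_(i < k) bar i q = 0.
    by rewrite bar1 => /eqP; rewrite oner_eq0.
  apply: big1 => i _; apply/eqP; apply: contrapT => /negP qi.
  by apply: Nq; exists i.
have [M [W [[Wopen Wcov] Wref Wmult]]] := Hdim _ _ Ucov.
have {Wref}/choice[idx idxP] := Wref.
(* Members of the refinement are grouped by a chosen [U i] containing them. Pulled back along [psi],
   group [i] misses the face where coordinate [i] vanishes, since [bar i (psi t) = t 0 i]. *)
have [|||t st tW] := @kkm R n.+1 (fun i t => exists2 j, idx j = i & W j (psi t)).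
- move=> t /psiE/Wcov[j _ Wj]; exists (idx j), j => //.
- move=> i t st [j ji Wj]; have [_ /(_ _ Wj)[eps eps0 Heps]] := Wopen j.
  have C0 : 0 < l * (2 * k%:R) by rewrite !mulr_gt0// ltr0n.
  exists (eps / (l * (2 * k%:R))); first by rewrite divr_gt0.
  move=> u su tu; exists j => //; apply: Heps; first exact: psiE.
  apply: le_lt_trans (fold_simplex_dist x0 l0 f c0 c1 cS (simplexP _ st) (simplexP _ su)) _.
  move: tu; rewrite ltr_pdivlMr//; apply: le_lt_trans.
  rewrite [leRHS]mulrCA ler_pM2l// [leRHS]mulrCA ler_pM2l//.
  apply: (@le_trans _ _ (\sum_(i < k) `|t - u|)).
    by apply: ler_sum => a _; apply: le_trans (rV_coord_le _ a); rewrite !mxE.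
  by rewrite sumr_const card_ord mulr_natr.
- by move=> i t st [j <- /idxP[_]]; rewrite bar_psi.
have {tW}/choice[j jP] : forall i, exists j, idx j = i /\ W j (psi t).
  by move=> i; have [j] := tW i; exists j.
(* Members from different groups are different, so the common point lies in [n.+2] of them. *)
have := Wmult (psi t) [set j i | i in 'I_n.+2]%SET.
rewrite card_imset; last by move=> a b ab; rewrite -(jP a).1 ab (jP b).1.
rewrite card_ord ltnn => Wm; suff : false by [].
by apply: Wm => _ /imsetP[i _ ->]; have [] := jP i.
Qed.

(** * Chains of lattice points *)

Lemma parity_neq (R : numDomainType) (a b : int) (s : R) : s = 1 \/ s = -1 ->
  2 * a%:~R + s <> 2 * b%:~R.
Proof.
have h (c e : int) : 2 * c%:~R + 1 <> 2 * e%:~R :> R.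
  move=> E; have : (2 * c + 1)%:~R = (2 * e)%:~R :> R.
    by rewrite intrD !intrM.
  by move=> /intr_inj; lia.
move=> [->|->]; first exact: h.
by move=> E; apply: (h b a); rewrite -E addrNK.
Qed.

Section Chains.
Variables (R : realType) (X : Type) (l : R).
Hypothesis l0 : 0 < l.
Implicit Types (p q r : X -> R) (x : X).

(* Moving up in this order rounds some even coordinates to a neighbouring odd
   value, so that its chains are the simplices of the subdivision. *)
Definition parity_le p q : Prop := forall x, p x = q x \/
  exists (a : int) (s : R), [/\ s = 1 \/ s = -1, p x = l * (2 * a%:~R) &
    q x = l * (2 * a%:~R + s)].

Lemma parity_le_refl p : parity_le p p. Proof. by move=> x; left. Qed.

Let lI := mulfI (lt0r_neq0 l0).

Lemma parity_le_trans q p r : parity_le p q -> parity_le q r -> parity_le p r.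
Proof.
move=> pq qr x; case: (pq x) => [->//|[a [s [s1 pE qE]]]].
case: (qr x) => [<-|[b [s' [_ qE' _]]]]; first by right; exists a, s.
by move: qE'; rewrite qE => /lI /(parity_neq s1).
Qed.

Section Sorted.
Variables (n : nat) (u : 'I_n.+1 -> X -> R).
Hypothesis u_sorted : forall i j : 'I_n.+1, (i <= j)%N -> parity_le (u i) (u j).

(** An odd value never moves again, so each coordinate jumps at most once along the chain, at index
    [j0]. Here [n.+1] encodes a constant even value, and 0 a constant odd value, normalized to
    [s = 1]. *)
Lemma chain_local x (k : int) : u ord0 x = l * k%:~R ->
  exists (a : int) (s : R) (j0 : nat),
    [/\ s = 1 \/ s = -1, (j0 <= n.+1)%N, j0 = 0%N -> s = 1
      & forall i, u i x = l * (2 * a%:~R + s * (j0 <= i)%N%:R)].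
Proof.
move=> u0; have [b kE] : exists b : int, k = 2 * b \/ k = 2 * b + 1.
  by exists (k %/ 2)%Z; have := divz_eq k 2; have := ltz_pmod k (isT : 0 < 2 :> int);
     have := modz_ge0 k (isT : 2 != 0 :> int); lia.
case: kE => kE; last first.
  exists b, 1, 0%N; split=> //; first by left.
  move=> i; rewrite mulr1 (_ : u i x = u ord0 x).
    by rewrite u0 kE intrD intrM.
  case: (u_sorted (leq0n i : (ord0 <= i)%N) x) => // -[a [s [s1 + _]]].
  rewrite u0 kE => /lI; rewrite intrD intrM => /parity_neq.
  by case; left.
have [eq|] := pselect (forall i, u i x = u ord0 x).
  exists b, 1, n.+1; split=> //; first by left.
  by move=> i; rewrite eq u0 kE ltn_geF ?ltn_ord// mulr0 addr0 intrM.
move=> /existsNP[i1 /eqP i1P].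
case: (arg_minnP (fun i : 'I_n.+1 => i : nat) (i1P : (fun i => u i x != u ord0 x) i1)).
move=> j /eqP ju jmin.
case: (u_sorted (leq0n j : (ord0 <= j)%N) x) => [/esym//|[a [s [s1 E0 Ej]]]].
exists a, s, j; split=> //.
- exact: ltnW.
- by move=> j0; case: ju; congr (u _ x); apply: val_inj.
- move=> i; have [ji|ij] := leqP j i; last first.
    rewrite mulr0 addr0 -E0; apply: contrapT => /eqP /jmin.
    by rewrite leqNgt ij.
  rewrite mulr1 -Ej; case: (u_sorted ji x) => // -[b' [s' [_ + _]]].
  by rewrite Ej => /lI /(parity_neq s1).
Qed.

End Sorted.

(** The weight of the vertices past a jump at [j]; by [chain_combination] it measures how far a
    convex combination has moved from the even value there. *)
Definition tail_sum n (t : 'I_n -> R) (j : nat) : R := \sum_(i < n | (j <= i)%N) t i.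

Lemma tail_sum0 n (t : 'I_n -> R) : tail_sum t 0 = \sum_i t i.
Proof. exact: eq_bigl. Qed.

Lemma tail_sum_last n (t : 'I_n -> R) j : (n <= j)%N -> tail_sum t j = 0.
Proof.
by move=> nj; apply: big_pred0 => i; rewrite leqNgt (leq_trans (ltn_ord i) nj).
Qed.

Lemma tail_sumS n (t : 'I_n -> R) (j : 'I_n) :
  tail_sum t j = t j + tail_sum t j.+1.
Proof.
rewrite /tail_sum (bigD1 j)//=; congr (_ + _); apply: eq_bigl => i.
by rewrite ltn_neqAle andbC eq_sym.
Qed.

Lemma tail_sum_le n (t : 'I_n -> R) i j : (forall a, 0 <= t a) -> (i <= j)%N ->
  tail_sum t j <= tail_sum t i.
Proof.
move=> t0 ij; rewrite /tail_sum big_mkcond [leRHS]big_mkcond; apply: ler_sum => a _.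
case: ifP => [ja|_]; first by rewrite (leq_trans ij ja).
by case: ifP.
Qed.

Lemma tail_sum_itv n (t : 'I_n -> R) j : convex_weights t -> 0 <= tail_sum t j <= 1.
Proof.
move=> [t0 t1]; rewrite sumr_ge0//= -t1 -tail_sum0.
exact: tail_sum_le.
Qed.

Lemma chain_combination n (t : 'I_n -> R) (u : 'I_n -> R) (a : int) (s : R) (j0 : nat) :
  convex_weights t -> (forall i, u i = l * (2 * a%:~R + s * (j0 <= i)%N%:R)) ->
  \sum_i t i * u i = l * (2 * a%:~R + s * tail_sum t j0).
Proof.
move=> [t0 t1] uE; rewrite /tail_sum [in RHS]big_mkcond mulrDr mulr_sumr mulr_sumr.
have -> : l * (2 * a%:~R) = \sum_i t i * (l * (2 * a%:~R)) by rewrite -mulr_suml t1 mul1r.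
rewrite -big_split/=; apply: eq_bigr => i _; rewrite uE.
by case: ifP => _; rewrite ?mulr1 ?mulr0; lra.
Qed.

End Chains.

(** * The complex of finite chains *)

Section Complex.
Variables (R : realType) (X : Type) (x0 : X) (m : X -> X -> nat) (l : R).
Hypothesis l0 : 0 < l.

Let d x y : R := l * (2 * m x y)%:R.

Local Notation V := (lattice_points m l).
Local Notation F := (X -> R).

Let lI := mulfI (lt0r_neq0 l0).

Definition chain_complex : set (set F) := [set s |
  [/\ finite_set s, s !=set0, s `<=` V &
      forall p q, s p -> s q -> parity_le l p q \/ parity_le l q p]].

Local Notation K := chain_complex.

Lemma chain_complexP : abstract_complex V K.
Proof.
move=> s [fs s0 sV sC]; split=> // s' s'0 s's; split=> //.
- exact: sub_finite_set fs.
- exact: subset_trans sV.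
- by move=> p q /s's ps /s's qs; apply: sC.
Qed.

Lemma chain_complex1 v : K [set v] <-> V v.
Proof.
split=> [[_ _ sV _]|Vv]; first exact: sV.
split; [exact: finite_set1 | by exists v | by move=> _ -> |].
by move=> _ _ -> ->; left; apply: parity_le_refl.
Qed.

Lemma chain_enum s : K s -> exists (n : nat) (u : 'I_n.+1 -> F),
  enumerates u s /\ forall i j : 'I_n.+1, (i <= j)%N -> parity_le l (u i) (u j).
Proof.
move=> [/finite_seqP[r sE] [v0 sv0] _ sC].
pose le (p q : F) := `[< parity_le l p q >].
have le_trans : transitive le.
  by move=> q p t /asboolP pq /asboolP qt; apply/asboolP/(parity_le_trans l0 pq).
pose r' := sort le (undup r).
have mem_r' v : (v \in r') = `[< s v >].
  by rewrite mem_sort mem_undup sE; apply/idP/asboolP.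
have r'_sorted : sorted le r'.
  apply: (@sort_sorted_in _ [pred v | v \in r'] le); last first.
    by apply/allP => v; rewrite inE mem_sort.
  move=> p q; rewrite !inE !mem_r' => /asboolP ps /asboolP qs.
  by apply/orP; have [h|h] := sC _ _ ps qs; [left|right]; apply/asboolP.
have r'_uniq : uniq r' by rewrite sort_uniq undup_uniq.
have size_r' : size r' = (size r').-1.+1.
  rewrite prednK// lt0n size_eq0; apply/eqP => r0.
  have : v0 \in r' by rewrite mem_r'; apply/asboolP.
  by rewrite r0.
have nth_lt (i : 'I_(size r').-1.+1) : (i < size r')%N.
  by apply: leq_trans (ltn_ord i) _; rewrite -size_r'.
exists (size r').-1, (fun i => nth v0 r' i); split; last first.
  move=> i j ij; apply/asboolP.
  apply: (sorted_leq_nth le_trans _ v0 r'_sorted) => //; rewrite ?inE//.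
  by move=> p; apply/asboolP/parity_le_refl.
split.
- by move=> i _; apply/asboolP; rewrite -mem_r' mem_nth.
- move=> i j _ _ /eqP; rewrite nth_uniq// => /eqP ij; exact: val_inj.
- move=> v /asboolP; rewrite -mem_r' => vr.
  have iv : (index v r' < (size r').-1.+1)%N by rewrite -size_r' index_mem.
  by exists (Ordinal iv) => //=; rewrite nth_index.
Qed.

Lemma fsum_enumerates n (u : 'I_n -> F) (s : set F) (f : F -> R) :
  enumerates u s -> (forall v, f v != 0 -> s v) ->
  \sum_(v \in [set: F]) f v = \sum_i f (u i).
Proof.
move=> us fs; rewrite -(@fsbig_widen _ _ _ _ s)//; last first.
  by move=> v [_ sv] /=; apply/eqP; apply: contrapT => /negP /fs.
have fT : finite_set [set: 'I_n] by exact: finite_finset.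
rewrite (reindex_fsbig u [set: 'I_n])// fsbig_finite//=.
  rewrite (perm_big (enum 'I_n)) ?big_enum//=.
  apply: uniq_perm; rewrite ?enum_uniq ?finmap.fset_uniq// => i.
  by rewrite in_fset_set// mem_enum in_setT.
Qed.

(** Both sides are multiples of [l], so a partner with error less than [l] is exact. *)
Lemma V_attained v x : V v -> exists y, v x + v y = d x y.
Proof.
move=> [/(hullP x0)[Dv Ev] Vv]; have [y xy] := Ev x _ l0; exists y.
have := Dv x y; move: xy; rewrite /d.
have [i ->] := Vv x; have [j ->] := Vv y; rewrite -mulrDr -natrD => h1 h2.
congr (_ * _); apply/eqP; rewrite eqr_nat eqn_leq; apply/andP; split; last first.
  by rewrite -(ler_nat R) -(ler_pM2l l0).
rewrite -ltnS -(ltr_nat R) -(ltr_pM2l l0); apply: (lt_le_trans h1).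
by rewrite -natr1 mulrDr mulr1.
Qed.

Section SortedChain.
Variables (n : nat) (u : 'I_n.+1 -> F).
Hypotheses (uV : forall i, V (u i))
  (u_sorted : forall i j : 'I_n.+1, (i <= j)%N -> parity_le l (u i) (u j)).

Lemma sorted_chain_local x : exists (a : int) (s : R) (j0 : nat),
    [/\ s = 1 \/ s = -1, (j0 <= n.+1)%N, j0 = 0%N -> s = 1
      & forall i, u i x = l * (2 * a%:~R + s * (j0 <= i)%N%:R)].
Proof.
by have [k kE] := (uV ord0).2 x; apply: (chain_local l0 u_sorted (k := k)).
Qed.

(* The partner [y] of [x] is taken at the vertex next to the jump at [x] whose
   value at [x] is the larger one: across the jump the inequality
   [d x y <= p x + p y] forces the value at [y] to increase by the same amount. *)
Lemma sorted_chain_attained x : exists y, forall i, u i x + u i y = d x y.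
Proof.
have [a [s [j0 [s1 j0n j00 xE]]]] := sorted_chain_local x.
have [i0 i0P] : exists i0 : 'I_n.+1, (j0 = i0 /\ s = 1) \/
    (j0 = i0.+1 /\ (s = -1 \/ j0 = n.+1)).
  have [j0n'|j0n'] := ltnP j0 n.+1; last first.
    have j0E : j0 = n.+1 by apply/eqP; rewrite eqn_leq j0n.
    by exists ord_max; right; split; [|right].
  case: s1 => s1; first by exists (Ordinal j0n'); left.
  case: j0 j00 j0n' {j0n xE} => [/(_ erefl) s1'|j0 _ j0n].
    by exfalso; move: s1; rewrite s1'; lra.
  by exists (Ordinal (ltnW j0n)); right; split; [|left].
have [y xy] := V_attained x (uV i0); exists y.
have [b [s' [j1 [s1' _ _ yE]]]] := sorted_chain_local y.
have Dxy i : d x y <= u i x + u i y by apply: (hull_Delta (uV i).1).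
have dE : d x y = l * (2 * (m x y)%:R) by rewrite /d natrM.
move=> i; suff H : 2 * a%:~R + s * (j0 <= i)%N%:R +
    (2 * b%:~R + s' * (j1 <= i)%N%:R) = 2 * (m x y)%:R :> R.
  by rewrite xE yE -mulrDr H dE.
have {}Dxy (j : 'I_n.+1) : 2 * (m x y)%:R <=
    2 * a%:~R + s * (j0 <= j)%N%:R + (2 * b%:~R + s' * (j1 <= j)%N%:R) :> R.
  by rewrite -(ler_pM2l l0) -dE (le_trans (Dxy j))// xE yE -mulrDr.
have {}xy : 2 * a%:~R + s * (j0 <= i0)%N%:R + (2 * b%:~R + s' * (j1 <= i0)%N%:R) =
    2 * (m x y)%:R :> R.
  by apply: lI; rewrite -dE -xy xE yE -mulrDr.
have odd_even (c e : int) (t : R) : t = 1 \/ t = -1 -> 2 * c%:~R + t = 2 * e%:~R -> False.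
  by move=> t1 /(parity_neq t1).
(* At the vertex [i0] the two coordinates add up to an even integer, so they are both even or both
   odd. *)
have j10 : (j1 <= i0)%N = (j0 <= i0)%N.
  move: xy; case: (leqP j1 i0) => _; case: (leqP j0 i0) => _ //;
    rewrite /= ?mulr0 ?mulr1 ?addr0 => E.
  - by case: (odd_even (a + b) (m x y) s' s1'); rewrite intrD -pmulrn mulrDr -addrA.
  - by case: (odd_even (a + b) (m x y) s s1); rewrite intrD -pmulrn mulrDr addrAC.
move: xy (Dxy i); rewrite j10; case: i0P => [[j0E sE]|[j0E sE]].
- rewrite j0E leqnn sE !mulr1 mul1r in j10 *.
  have [i0i|ii0] := leqP i0 i; first by rewrite (leq_trans j10 i0i)/=; lra.
  by case: s1' => ->; case: (j1 <= i)%N => /=; lra.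
- have [i0i|ii0] := leqP j0 i; last first.
    have -> : (j1 <= i)%N = false.
      apply/negbTE; rewrite -ltnNge; move: j10; rewrite j0E ltnn => /negbT.
      rewrite -ltnNge; apply: leq_ltn_trans.
      by move: ii0; rewrite j0E ltnS.
    by rewrite j0E ltnn /=; lra.
  have -> : s = -1.
    by case: sE => // j0E'; have := leq_trans (ltn_ord i) (eq_leq (esym j0E')); rewrite ltnNge i0i.
  by rewrite j0E ltnn; case: s1' => ->; case: (j1 <= i)%N => /=; lra.
Qed.

Lemma sorted_chain_hull (t : 'I_n.+1 -> R) : convex_weights t ->
  hull d (fun x => \sum_i t i * u i x).
Proof.
move=> [t0 t1]; apply/(hullP x0); split=> [x y|x eps eps0].
  rewrite -big_split/= -[leLHS]mul1r -t1 mulr_suml; apply: ler_sum => i _.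
  by rewrite -mulrDr ler_wpM2l// (hull_Delta (uV i).1).
have [y xy] := sorted_chain_attained x; exists y.
rewrite -big_split/= (eq_bigr (fun i => t i * d x y)) => [|i _]; last by rewrite -mulrDr xy.
by rewrite -mulr_suml t1 mul1r ltrDl.
Qed.

Lemma sorted_chain_combination (t : 'I_n.+1 -> R) x : convex_weights t ->
  exists (a : int) (s : R) (j0 : nat),
    [/\ s = 1 \/ s = -1, (j0 <= n.+1)%N,
        forall i, u i x = l * (2 * a%:~R + s * (j0 <= i)%N%:R)
      & forall t', convex_weights t' ->
        \sum_i t' i * u i x = l * (2 * a%:~R + s * tail_sum t' j0)].
Proof.
move=> tw; have [a [s [j0 [s1 j0n _ uE]]]] := sorted_chain_local x.
by exists a, s, j0; split=> // t' tw'; apply: chain_combination.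
Qed.

End SortedChain.
End Complex.

(** A fold value at most [c] is rounded to the even centre, a larger one to the neighbouring odd
    integer. The complementary large and strict inequalities give uniqueness. *)
Definition rounds_to (R : realType) (c y z : R) : Prop :=
  (exists2 a : int, z = 2 * a%:~R & `|y - z| <= c) \/
  (exists2 a : int, z = 2 * a%:~R + 1 & `|y - z| < 1 - c).

Lemma rounds_to_uniq (R : realType) (c y z z' : R) : 0 <= c < 1 ->
  rounds_to c y z -> rounds_to c y z' -> z = z'.
Proof.
move=> /andP[c0 c1].
have same (a b : int) : `|2 * a%:~R - 2 * b%:~R| < (2 : R) -> a = b.
  move=> h; have h1 : (a%:~R : R) < (b + 1)%:~R.
    by rewrite intrD; move: h; rewrite ltr_norml; lra.
  have h2 : (b%:~R : R) < (a + 1)%:~R.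
    by rewrite intrD; move: h; rewrite ltr_norml; lra.
  by move: h1 h2; rewrite !ltr_int; lia.
have diff (a b : int) : `|2 * a%:~R - (2 * b%:~R + 1)| < (1 : R) -> False.
  move=> h; have h1 : (a%:~R : R) < (b + 1)%:~R.
    by rewrite intrD; move: h; rewrite ltr_norml; lra.
  have h2 : (b%:~R : R) < a%:~R.
    by move: h; rewrite ltr_norml; lra.
  by move: h1 h2; rewrite !ltr_int; lia.
move=> [[a -> ya]|[a -> ya]] [[b -> yb]|[b -> yb]].
- congr (2 * _%:~R); apply: same; move: ya yb.
  by rewrite !ler_norml ltr_norml; lra.
- case: (diff a b); move: ya yb.
  by rewrite !ler_norml !ltr_norml; lra.
- case: (diff b a); move: ya yb.
  by rewrite !ler_norml !ltr_norml; lra.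
- congr (2 * _%:~R + 1); apply: same; move: ya yb.
  by rewrite !ltr_norml; lra.
Qed.

Lemma tail_sum_cell (R : realType) n (t : 'I_n.+1 -> R) (c : R) :
  convex_weights t -> 0 <= c < 1 ->
  exists j : 'I_n.+1, tail_sum t j.+1 <= c < tail_sum t j.
Proof.
move=> tw /andP[c0 c1].
have ex : exists j, tail_sum t j <= c.
  by exists n.+1; rewrite tail_sum_last.
case: (ex_minnP ex) => -[|j] jc jmin.
  by move: jc; rewrite tail_sum0 tw.2 leNgt c1.
have jn : (j < n.+1)%N by apply: jmin; rewrite tail_sum_last.
exists (Ordinal jn); rewrite jc /= ltNge; apply/negP => /jmin.
by rewrite ltnn.
Qed.

(** * Affine realization of chains: injectivity and continuity *)

Section Realization.
Variables (R : realType) (X : Type) (x0 : X) (m : X -> X -> nat) (l : R).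
Hypothesis l0 : 0 < l.

Let d x y : R := l * (2 * m x y)%:R.

Local Notation V := (lattice_points m l).
Local Notation F := (X -> R).
Local Notation K := (chain_complex m l).

Definition affine_realize (t : F -> R) : F :=
  fun x => \sum_(v \in [set: F]) t v * v x.

Definition vertex_weights n (v : 'I_n -> F) (t : 'I_n -> R) : F -> R :=
  fun w => \sum_i t i * (w == v i)%:R.

Lemma face_weights s n (v : 'I_n -> F) t : enumerates v s ->
  geometric_face K s t -> convex_weights (t \o v) /\
  forall x, affine_realize t x = \sum_i t (v i) * v i x.
Proof.
move=> vs [[_ t0 t1] ts]; split; last first.
  move=> x; rewrite /affine_realize (fsum_enumerates vs)// => w tw.
  by apply: ts; apply: contraNneq tw => ->; rewrite mul0r.
split=> [i|]; first exact: t0.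
by rewrite -t1 (fsum_enumerates vs)// => w tw; apply: ts.
Qed.

Lemma vertex_weights_sum s n N (v : 'I_n -> F) (u : 'I_N -> F) t (f : F -> R) :
  enumerates u s -> (forall i, s (v i)) ->
  \sum_j vertex_weights v t (u j) * f (u j) = \sum_i t i * f (v i).
Proof.
move=> [_ uinj usurj] sv; rewrite /vertex_weights.
under eq_bigr do rewrite mulr_suml; rewrite exchange_big/=; apply: eq_bigr => i _.
have [j _ ji] := usurj _ (sv i).
rewrite (bigD1 j)//= ji eqxx mulr1 big1 ?addr0// => k kj.
have /negbTE-> : u k != v i.
  by apply: contraNneq kj; rewrite -ji => /uinj->//; rewrite inE.
by rewrite mulr0 mul0r.
Qed.

(** Repetitions in [v] are allowed, their weights adding up, so a listing of vertices need not be
    shown injective. *)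
Lemma vertex_weights_face s n (v : 'I_n -> F) t : K s -> (forall i, s (v i)) ->
  convex_weights t -> geometric_face K s (vertex_weights v t) /\
  forall x, affine_realize (vertex_weights v t) x = \sum_i t i * v i x.
Proof.
move=> Ks sv [t0 t1]; have [N [u [us _]]] := chain_enum l0 Ks.
have ws w : vertex_weights v t w != 0 -> s w.
  move=> w0; apply: contrapT => sw; move/eqP: w0; apply; apply: big1 => i _.
  by have /negbTE-> : w != v i by [apply/eqP => wi; apply: sw; rewrite wi]; rewrite mulr0.
have sumE (f : F -> R) :
    \sum_(w \in [set: F]) vertex_weights v t w * f w = \sum_i t i * f (v i).
  rewrite (fsum_enumerates us) ?(vertex_weights_sum _ _ us sv)// => w wf.
  by apply: ws; apply: contraNneq wf => ->; rewrite mul0r.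
have sum1 : \sum_(w \in [set: F]) vertex_weights v t w = 1.
  rewrite -t1 (fsum_enumerates us)//.
  have := vertex_weights_sum t (fun=> 1) us sv.
  by under eq_bigr do rewrite mulr1; under [RHS]eq_bigr do rewrite mulr1.
split; last by move=> x; apply: (sumE (fun w => w x)).
split; last exact: ws.
split=> //; last by move=> w; apply: sumr_ge0 => i _; rewrite mulr_ge0.
have [_ _ _ Ksub] := chain_complexP Ks; apply: Ksub => //.
have [//|/set0P/negP/negPn/eqP w0] := pselect (supp (vertex_weights v t) !=set0).
move: sum1; rewrite fsbig1 => [/eqP|w _]; first by rewrite eq_sym oner_eq0.
apply/eqP; apply: contrapT => /negP wn.
by have : supp (vertex_weights v t) w by []; rewrite w0.
Qed.

Lemma vertex_weights_val n (v : 'I_n -> F) t i : injective v ->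
  vertex_weights v t (v i) = t i.
Proof.
move=> vinj; rewrite /vertex_weights (bigD1 i)//= eqxx mulr1 big1 ?addr0// => j ji.
by rewrite (inj_eq vinj) eq_sym (negbTE ji) mulr0.
Qed.

Lemma enumerates_inj n (v : 'I_n -> F) s : enumerates v s -> injective v.
Proof. by move=> [_ vinj _] i j /vinj; rewrite !inE; apply. Qed.

Lemma chain_face_enum s : K s -> exists n (u : 'I_n.+1 -> F),
  [/\ enumerates u s, forall i, V (u i) &
      forall i j : 'I_n.+1, (i <= j)%N -> parity_le l (u i) (u j)].
Proof.
move=> Ks; have [n [u [us u_sorted]]] := chain_enum l0 Ks; exists n, u; split=> //.
by move=> i; have [_ _ sV _] := Ks; apply: sV; case: us => + _ _; apply.
Qed.

Lemma affine_realize_hull t : geometric_realization K t -> hull d (affine_realize t).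
Proof.
move=> Kt; have [Ks _ _] := Kt; have [n [u [us uV u_sorted]]] := chain_face_enum Ks.
have [tw tE] := face_weights us (conj Kt (fun v h => h)).
rewrite (_ : affine_realize t = fun x => \sum_i t (u i) * u i x); last exact/funext.
exact: (sorted_chain_hull x0 l0 uV u_sorted tw).
Qed.

(* The vertex [v] of the carrier of [p] is recovered as the common rounding of
   the coordinates of [p / l] for all thresholds in an interval of length [t v]. *)
Lemma affine_realize_rounds t (p := affine_realize t)
    (I := fun (c : R) (v : F) => forall x, rounds_to c (p x / l) (v x / l)) :
  geometric_realization K t -> forall v,
  (t v = 0 -> forall c, 0 <= c < 1 -> ~ I c v) /\
  (t v != 0 -> exists a, [/\ 0 <= a, a + t v <= 1 & forall c, 0 <= c < 1 ->
    I c v <-> a <= c < a + t v]).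
Proof.
move=> Kt; have [Ks t0 _] := Kt; have [n [u [us uV u_sorted]]] := chain_face_enum Ks.
have [tw tE] := face_weights us (conj Kt (fun v h => h)).
have uinj := enumerates_inj us.
have cellI c (j : 'I_n.+1) : 0 <= c < 1 ->
    tail_sum (t \o u) j.+1 <= c < tail_sum (t \o u) j -> I c (u j).
  move=> /andP[c0 c1] /andP[jc cj] x.
  have [a [s [j0 [s1 j0n uE combE]]]] := sorted_chain_combination l0 uV u_sorted x tw.
  have lK (y : R) : l * y / l = y by rewrite mulrC mulKf ?gt_eqF.
  rewrite /p tE (combE (t \o u) tw) uE !lK.
  have /andP[T0 T1] := tail_sum_itv j0 tw.
  have [j0j|jj0] := leqP j0 j.
    have Tc : c < tail_sum (t \o u) j0.
      by apply: (lt_le_trans cj); apply: tail_sum_le tw.1 _.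
    right; move: Tc T0 T1; move: (tail_sum _ _) => T Tc T0 T1; rewrite /= mulr1.
    case: s1 => ->.
      by exists a => //; rewrite ltr_norml; lra.
    exists (a - 1); first by rewrite intrB; lra.
    by rewrite ltr_norml; lra.
  have Tc : tail_sum (t \o u) j0 <= c.
    by apply: le_trans jc; apply: tail_sum_le tw.1 _.
  left; exists a; first by rewrite mulr0 addr0.
  move: Tc T0 T1; move: (tail_sum _ _) => T Tc T0 T1; rewrite /= mulr0.
  by case: s1 => ->; rewrite ler_norml; lra.
have Iuniq c v w : 0 <= c < 1 -> I c v -> I c w -> v = w.
  move=> c01 Iv Iw; apply/funext => x.
  have := rounds_to_uniq c01 (Iv x) (Iw x).
  by move=> /(mulIf (invr_neq0 (lt0r_neq0 l0))).
move=> v; split=> [tv0 c c01 Iv|tv0].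
  have [j jc] := tail_sum_cell tw c01.
  have [usupp _ _] := us; have : supp t (u j) by apply: usupp.
  by rewrite -(Iuniq _ _ _ c01 Iv (cellI _ _ c01 jc)) /supp/= tv0 eqxx.
have [_ _ usurj] := us; have [i _ ui] := usurj _ tv0.
have tailE : tail_sum (t \o u) i = tail_sum (t \o u) i.+1 + t v.
  by rewrite tail_sumS addrC /= ui.
exists (tail_sum (t \o u) i.+1); rewrite -tailE.
have /andP[T0 _] := tail_sum_itv i.+1 tw; have /andP[_ T1] := tail_sum_itv i tw.
split=> // c c01; rewrite -ui; split=> [Iv|]; last exact: cellI.
have [j jc] := tail_sum_cell tw c01.
by rewrite (uinj _ _ (Iuniq _ _ _ c01 Iv (cellI _ _ c01 jc))).
Qed.

(** The image determines which vertices occur and, for each of them, the interval of thresholds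
    rounding to it, whose length is the weight. *)
Lemma affine_realize_inj t t' : geometric_realization K t ->
  geometric_realization K t' -> affine_realize t = affine_realize t' -> t = t'.
Proof.
move=> Kt Kt' tt'; apply/funext => v.
have [_ t0 _] := Kt; have [_ t0' _] := Kt'.
have [Z P] := affine_realize_rounds Kt v.
have [Z' P'] := affine_realize_rounds Kt' v; rewrite -tt' in Z' P'.
have [tv0|tvn] := eqVneq (t v) 0; have [tv0'|tvn'] := eqVneq (t' v) 0.
- by rewrite tv0 tv0'.
- have [a [a0 a1 aP]] := P' tvn'; have tvp : 0 < t' v by rewrite lt0r tvn' t0'.
  have a01 : 0 <= a < 1 by rewrite a0/=; lra.
  by case: (Z tv0 _ a01); apply/aP => //; rewrite lexx/=; lra.
- have [a [a0 a1 aP]] := P tvn; have tvp : 0 < t v by rewrite lt0r tvn t0.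
  have a01 : 0 <= a < 1 by rewrite a0/=; lra.
  by case: (Z' tv0' _ a01); apply/aP => //; rewrite lexx/=; lra.
have [a [a0 a1 aP]] := P tvn; have tvp : 0 < t v by rewrite lt0r tvn t0.
have [b [b0 b1 bP]] := P' tvn'; have tvp' : 0 < t' v by rewrite lt0r tvn' t0'.
have a01 : 0 <= a < 1 by rewrite a0/=; lra.
have b01 : 0 <= b < 1 by rewrite b0/=; lra.
have /andP[ba _] : b <= a < b + t' v.
  by apply/(bP _ a01)/(aP _ a01); rewrite lexx/=; lra.
have /andP[ab _] : a <= b < a + t v.
  by apply/(aP _ b01)/(bP _ b01); rewrite lexx/=; lra.
have abE : a = b by apply/eqP; rewrite eq_le ab ba.
(* With equal left ends, the right end of the shorter half-open interval belongs only to the longer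
   one. *)
subst b; apply/eqP; rewrite eq_le !leNgt; apply/andP; split; apply/negP => tlt.
- have c01 : 0 <= a + t' v < 1 by apply/andP; split; lra.
  have /(bP _ c01) /andP[_] : forall x, rounds_to (a + t' v) (affine_realize t x / l) (v x / l).
    by apply/(aP _ c01)/andP; split; lra.
  by rewrite ltxx.
- have c01 : 0 <= a + t v < 1 by apply/andP; split; lra.
  have /(aP _ c01) /andP[_] : forall x, rounds_to (a + t v) (affine_realize t x / l) (v x / l).
    by apply/(bP _ c01)/andP; split; lra.
  by rewrite ltxx.
Qed.

Lemma parity_le_dist (p q : F) x : parity_le l p q -> `|q x - p x| <= l.
Proof.
move=> /(_ x)[->|[a [s [s1 -> ->]]]]; first by rewrite subrr normr0 ltW.
rewrite -mulrBr addrAC subrr add0r normrM gtr0_norm//.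
by case: s1 => ->; rewrite ?normrN normr1 mulr1.
Qed.

Lemma affine_realize_continuous s t (eps : R) : K s -> geometric_face K s t -> 0 < eps ->
  exists2 eta : R, 0 < eta & forall t', geometric_face K s t' ->
    (forall v, `|t v - t' v| < eta) ->
    supdist (affine_realize t) (affine_realize t') < eps.
Proof.
move=> Ks ts eps0; have [n [u [us uV u_sorted]]] := chain_face_enum Ks.
have n0 : 0 < n.+1%:R :> R by rewrite ltr0n.
exists (eps / 2 / (l * n.+1%:R)); first by rewrite !divr_gt0 ?mulr_gt0.
move=> t' ts' tt'; apply: (@le_lt_trans _ _ (eps / 2)); last by rewrite ltr_pdivrMr//; lra.
apply: (supdist_le x0) => x.
have [[_ t1] ->] := face_weights us ts; have [[_ t1'] ->] := face_weights us ts'.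
have sum0 : \sum_i (t (u i) - t' (u i)) = 0.
  by rewrite sumrB [X in X - _]t1 [X in _ - X]t1' subrr.
(* The weight differences sum to 0, so the value at the first vertex may be subtracted; the
   remaining factors are at most [l], uniformly in [x]. *)
rewrite -sumrB (eq_bigr (fun i => (t (u i) - t' (u i)) * (u i x - u ord0 x) +
  (t (u i) - t' (u i)) * u ord0 x)); last by move=> i _; rewrite -mulrDr subrK mulrBl.
rewrite big_split/= -mulr_suml sum0 mul0r addr0.
apply: (le_trans (ler_norm_sum _ _ _)).
apply: (@le_trans _ _ (\sum_(i < n.+1) (eps / 2 / (l * n.+1%:R) * l))).
  apply: ler_sum => i _; rewrite normrM ler_pM//; first exact: ltW.
  exact/parity_le_dist/u_sorted.
rewrite sumr_const card_ord -[leLHS]mulr_natr -[leLHS]mulrA mulfVK//.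
by rewrite gt_eqF// mulr_gt0.
Qed.

End Realization.

(** * The subdivision *)

Section FiniteRange.
Variables (R : realType) (X : Type).

Lemma finite_range_sum (I : Type) (r : seq I) (t : I -> R) (f : I -> X -> R) :
  (forall i, finite_set (range (f i))) ->
  finite_set (range (fun x => \sum_(i <- r) t i * f i x)).
Proof.
move=> ff; elim: r => [|i r IH].
  by apply: (@sub_finite_set _ _ [set 0]) => // _ [x _ <-]; rewrite big_nil.
apply: (@sub_finite_set _ _ [set t i * ab.1 + ab.2 | ab in
    range (f i) `*` range (fun x => \sum_(i <- r) t i * f i x)]).
  move=> _ [x _ <-]; rewrite big_cons.
  by exists (f i x, \sum_(i <- r) t i * f i x) => //; split; exists x.
by apply: finite_image; apply: finite_setX.
Qed.

Lemma finite_set_max (A : set R) : finite_set A -> A !=set0 ->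
  exists2 a, A a & ubound A a.
Proof.
move=> /finite_seqP[r ->{A}] [a0 /= ar]; elim: r a0 ar => // b r IH a0.
have [->|[c cr]] : r = [::] \/ exists c, c \in r.
- by case: (r) => [|c r']; [left | right; exists c; rewrite mem_head].
- by move=> _; exists b => [|y] /=; rewrite ?mem_head// inE => /eqP->.
move=> _; have [a ar aP] := IH c cr; have [ab|ba] := leP a b.
- exists b => [|y] /=; first exact: mem_head.
  by rewrite inE => /predU1P[->//|/aP]; move/le_trans; apply.
- exists a => [|y] /=; first by rewrite inE ar orbT.
  by rewrite inE => /predU1P[->|/aP//]; apply: ltW.
Qed.

End FiniteRange.

(** * Surjectivity, orthosimplices and attained distances *)

Section Subdivision.
Variables (R : realType) (X : Type) (x0 : X) (m : X -> X -> nat) (l : R).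
Hypotheses (l0 : 0 < l) (mxx : forall x, m x x = 0%N)
  (mC : forall x y, m x y = m y x)
  (m_triangle : forall x y z, (m x z <= m x y + m y z)%N).

Let d x y : R := l * (2 * m x y)%:R.
Let dxx x : d x x = 0. Proof. by rewrite /d mxx muln0 mulr0. Qed.
Let d_triangle x y z : d x z <= d x y + d y z.
Proof.
by rewrite /d -mulrDr ler_pM2l// -natrD ler_nat -mulnDr leq_mul2l m_triangle.
Qed.
Let D : (X -> R) -> (X -> R) -> R := @supdist R X.

Local Notation V := (lattice_points m l).
Local Notation F := (X -> R).
Local Notation K := (chain_complex m l).

Lemma affine_realize_surj p : hull d p ->
  finite_set [set fold_value (p x / l) | x in [set: X]] ->
  exists2 t, geometric_realization K t & affine_realize t = p.
Proof.
move=> Ep /finite_seqP[r rE].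
pose s := sort <=%R (undup [seq a <- r | 0 < a < 1]).
have s_sorted : sorted <%R s.
  by rewrite lt_sorted_uniq_le sort_uniq undup_uniq sort_le_sorted.
have s01 a : a \in s -> 0 < a < 1 by rewrite mem_sort mem_undup mem_filter => /andP[].
pose c := threshold s; pose k := (size s).+1.
have cS i : (i < k)%N -> c i < c i.+1 by apply: threshold_lt.
have cI i := threshold_itv s01 i.
have c0 i : 0 <= c i by have /andP[] := cI i.
have c1 i : c i <= 1 by have /andP[] := cI i.
have ck : c k = 1 by apply: threshold_last.
have fold_c x : exists2 j, (j <= k)%N & fold_value (p x / l) = c j.
  have xr : fold_value (p x / l) \in r.
    by have : [set` r] (fold_value (p x / l)) by rewrite -rE; exists x.
  move: xr (fold_value_itv (p x / l)); move: (fold_value _) => y yr /andP[y0 y1].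
  have [yE|yn0] := eqVneq y 0; first by exists 0%N.
  have [yE|yn1] := eqVneq y 1; first by exists k; rewrite ?ck.
  have ys : y \in s.
    by rewrite mem_sort mem_undup mem_filter yr !lt_neqAle eq_sym yn0 yn1 y0 y1.
  by have [j js ->] := threshold_index ys; exists j => //; apply: leqW.
pose v (i : 'I_k) : F := fun x => l * fold_ramp (c i) (c i.+1) (p x / l).
have vE x : exists (e : int) (sg : R) j, [/\ sg = 1 \/ sg = -1, (j <= k)%N &
    forall i, v i x = l * (2 * e%:~R + sg * (i < j)%N%:R)].
  have [j jk jE] := fold_c x; have [e [sg [sg1 pE]]] := fold_valueP (p x / l).
  exists e, sg, j; split=> // i; rewrite /v pE jE.
  have [ij|ji] := ltnP i j.
    have cij : c i.+1 <= c j by apply: (nondecreasing_upto cS).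
    by rewrite fold_ramp_val ?cij ?orbT ?cS.
  have cij : c j <= c i by apply: (nondecreasing_upto cS) => //; apply: ltnW.
  rewrite fold_ramp_val ?cij ?cS// (_ : (c i.+1 <= c j) = false)//.
  by apply/negbTE; rewrite -ltNge (le_lt_trans cij)// cS.
have vV i : V (v i).
  have Ev : hull d (v i).
    apply: (hull_folding x0 l0 (folding_fold_ramp (c0 i) _ (c1 i.+1)) Ep).
    exact: cS.
  split=> // x; have := hull_ge0 dxx x Ev.
  have [e [sg [j [sg1 _ ->]]]] := vE x.
  have [z ->] : exists z : int, 2 * e%:~R + sg * (i < j)%N%:R = z%:~R :> R.
    case: sg1 => ->; case: (i < j)%N => /=.
    - by exists (2 * e + 1); rewrite intrD intrM mul1r.
    - by exists (2 * e); rewrite intrM mulr0 addr0.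
    - by exists (2 * e - 1); rewrite intrB intrM mulr1.
    - by exists (2 * e); rewrite intrM mulr0 addr0.
  rewrite pmulr_rge0// ler0z => z0; exists `|z|%N.
  by rewrite natr_absz ger0_norm.
have Kv : K [set v i | i in [set: 'I_k]].
  split.
  - by apply: finite_image; exact: finite_finset.
  - by exists (v ord0), ord0.
  - by move=> _ [i _ <-].
  (* A higher threshold rounds fewer coordinates to odd values, so the list [v] is decreasing. *)
  have v_le (i i' : 'I_k) : (i <= i')%N -> parity_le l (v i') (v i).
    move=> ii' x; have [e [sg [j [sg1 jk vx]]]] := vE x; rewrite !vx.
    have [i'j|ji'] := ltnP i' j; first by rewrite (leq_ltn_trans ii' i'j); left.
    case: (i < j)%N; last by left.
    by right; exists e, sg; rewrite mulr0 addr0 mulr1; split.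
  move=> _ _ [i _ <-] [i' _ <-]; have [ii'|/ltnW i'i] := leqP i i'.
    by right; apply: v_le.
  by left; apply: v_le.
have tau : convex_weights (fun i : 'I_k => c i.+1 - c i).
  split=> [i|]; first by rewrite subr_ge0 ltW// cS.
  rewrite -(big_mkord xpredT (fun i => c i.+1 - c i)) telescope_sumr//.
  by rewrite ck [c 0%N]/threshold subr0.
have [tf tE] := vertex_weights_face l0 Kv (fun i => imageT v i) tau.
exists (vertex_weights v (fun i : 'I_k => c i.+1 - c i)); first by case: tf.
apply/funext => x; rewrite tE /v.
under eq_bigr do rewrite mulrCA; rewrite -mulr_sumr sum_fold_ramp//.
by rewrite mulrC divfK// gt_eqF.
Qed.

(** For each pair of consecutive vertices choose a point [x j] of X where they differ. At these
    points a point of the simplex reads [l] times its tail sums, up to sign and a constant, as in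
    the orthosimplex. Any other point of X jumps at one of the same indices or not at all, so it
    gives no larger difference. *)
Lemma face_isometry s : K s ->
  exists (n : nat) (u : 'I_n.+1 -> F) (phi : F -> 'rV[R]_n),
    [/\ enumerates u s, forall k, phi (u k) = ortho_vertex l k,
        set_bij (@affine_realize R X @` geometric_face K s) (@orthosimplex R n l) phi
      & forall p q, (@affine_realize R X @` geometric_face K s) p ->
          (@affine_realize R X @` geometric_face K s) q -> `|phi p - phi q| = D p q].
Proof.
move=> Ks; have [n [u [us uV u_sorted]]] := chain_face_enum l0 Ks.
have uinj := enumerates_inj us.
have jump (j : 'I_n) : exists x, u (widen_ord (leqnSn n) j) x <> u (lift ord0 j) x.
  apply/existsNP => E; have /uinj/(congr1 val)/= : u (widen_ord (leqnSn n) j) = u (lift ord0 j).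
    exact/funext.
  by rewrite /bump/= add1n => /eqP; rewrite -[X in X == _]addn0 -addn1 eqn_add2l.
have [x xP] := choice jump.
pose phi (p : F) : 'rV[R]_n := \row_j `|p (x j) - u ord0 (x j)|.
have comb_x (t : 'I_n.+1 -> R) (j : 'I_n) : convex_weights t ->
    exists2 s : R, s = 1 \/ s = -1 & forall t', convex_weights t' ->
     \sum_i t' i * u i (x j) = u ord0 (x j) + l * (s * tail_sum t' j.+1) /\
     forall i, u i (x j) = u ord0 (x j) + l * (s * (j < i)%N%:R).
  move=> tw.
  have [a [sg [j0 [sg1 j0n uE cE]]]] := sorted_chain_combination l0 uV u_sorted (x j) tw.
  have j0E : j0 = j.+1.
    have := xP j; rewrite !uE /= /bump/= add1n.
    have [j0j|jj0] := leqP j0 j; first by rewrite (leqW j0j).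
    have [j0j1 _|//] := leqP j0 j.+1; first by apply/eqP; rewrite eqn_leq j0j1.
  exists sg => // t' tw'; rewrite cE// !uE j0E ltn0 mulr0 addr0 mulrDr; split=> // i.
  by rewrite uE j0E mulrDr.
have realE t : geometric_face K s t -> convex_weights (t \o u) /\
    forall y, affine_realize t y = \sum_i (t \o u) i * u i y.
  exact: face_weights.
have phiE t j : geometric_face K s t -> phi (affine_realize t) 0 j =
    l * tail_sum (t \o u) j.+1.
  move=> /realE[tw tE]; rewrite mxE tE.
  have [sg sg1 /(_ _ tw)[-> _]] := comb_x _ j tw.
  rewrite addrAC subrr add0r !normrM gtr0_norm//.
  have /andP[/ger0_norm-> _] := tail_sum_itv j.+1 tw.
  by case: sg1 => ->; rewrite ?normrN normr1 mul1r.
have orthoE (t : 'I_n.+1 -> R) j :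
    (\sum_k t k *: ortho_vertex l k) 0 j = l * tail_sum t j.+1.
  rewrite summxE /tail_sum [in RHS]big_mkcond mulr_sumr; apply: eq_bigr => k _.
  by rewrite !mxE; case: ifP => _; rewrite ?mulr0 // mulrC.
have hullK t : geometric_face K s t -> hull d (affine_realize t).
  by move=> [Kt _]; apply: affine_realize_hull.
have isom p q : (@affine_realize R X @` geometric_face K s) p ->
    (@affine_realize R X @` geometric_face K s) q -> `|phi p - phi q| = D p q.
  move=> [t tf <-] [t' tf' <-].
  have [tw tE] := realE _ tf; have [tw' tE'] := realE _ tf'.
  apply/eqP; rewrite eq_le; apply/andP; split.
    apply: rV_norm_le => [|j].
      by apply: (supdist_ge0 x0 d_triangle); apply: hullK.
    rewrite !mxE -/(phi _) -[X in `|X - _|]/(`|affine_realize t (x j) - _|).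
    have := phiE _ j tf; have := phiE _ j tf'; rewrite !mxE => -> ->.
    apply: le_trans (supdist_ge x0 d_triangle (x j) (hullK _ tf) (hullK _ tf')).
    rewrite tE tE'; have [sg sg1 cE] := comb_x _ j tw.
    rewrite (cE _ tw).1 (cE _ tw').1 opprD addrACA subrr add0r -!mulrBr !normrM.
    by case: sg1 => ->; rewrite ?normrN normr1 mul1r.
  apply: (supdist_le x0) => y; rewrite tE tE'.
  have [a [sg [j0 [sg1 j0n uE cE]]]] := sorted_chain_combination l0 uV u_sorted y tw.
  rewrite (cE _ tw) (cE _ tw') -mulrBr opprD addrACA subrr add0r -mulrBr !normrM.
  have -> : `|sg| = 1 by case: sg1 => ->; rewrite ?normrN normr1.
  rewrite mul1r gtr0_norm//.
  (* Jump indices 0 and [n.+1] are constant coordinates: both tail sums are 1, respectively 0. *)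
  case: j0 j0n {uE cE} => [_|j0].
    by rewrite !tail_sum0 tw.2 tw'.2 subrr normr0 mulr0.
  rewrite ltnS leq_eqVlt => /predU1P[->|j0n].
    by rewrite !tail_sum_last// subrr normr0 mulr0.
  apply: le_trans (rV_coord_le _ (Ordinal j0n)).
  have := phiE _ (Ordinal j0n) tf; have := phiE _ (Ordinal j0n) tf'.
  by rewrite !mxE => -> ->; rewrite -mulrBr normrM [X in _ <= X * _]gtr0_norm.
exists n, u, phi; split=> //.
- move=> k; apply/rowP => j; rewrite !mxE.
  have tw1 : convex_weights (fun i : 'I_n.+1 => (i == ord0)%:R : R).
    split=> [i|]; first exact: ler0n.
    by rewrite (bigD1 ord0)//= big1 ?addr0// => i /negbTE->.
  have [sg sg1 /(_ _ tw1)[_ ->]] := comb_x _ j tw1.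
  rewrite addrAC subrr add0r !normrM gtr0_norm//.
  have -> : `|sg| = 1 by case: sg1 => ->; rewrite ?normrN normr1.
  by case: (j < k)%N; rewrite mul1r /= ?normr1 ?normr0 ?mulr1 ?mulr0.
- split.
  + move=> _ [t tf <-]; have [tw _] := realE _ tf; exists (t \o u) => //.
    by apply/rowP => j; rewrite phiE// orthoE.
  + move=> p q /set_mem ps /set_mem qs pq.
    have := isom _ _ ps qs; rewrite pq subrr normr0 => /esym.
    by case: ps qs {pq} => t tf <- [t' tf' <-]; apply: (supdist_eq0 x0 d_triangle); apply: hullK.
  + move=> _ [t tw ->].
    have su i : s (u i) by case: us => + _ _; apply.
    have [tf tE] := vertex_weights_face l0 Ks su tw.
    exists (affine_realize (vertex_weights u t)); first by exists (vertex_weights u t).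
    apply/rowP => j; rewrite phiE// orthoE; congr (_ * tail_sum _ _).
    by apply/funext => i /=; rewrite vertex_weights_val.
Qed.

(** The difference of two hull points is bounded, and here its values are multiples of [l]. *)
Lemma finite_range_lattice u w : V u -> V w ->
  finite_set (range (fun x => u x - w x)).
Proof.
move=> [Eu Vu] [Ew Vw].
have [M MP] : exists M : nat, (u x0 + w x0) / l < M%:R.
  exists (Num.bound ((u x0 + w x0) / l)); apply: archi_boundP.
  by rewrite divr_ge0 ?addr_ge0 ?(ltW l0)// (hull_ge0 dxx).
apply: (@sub_finite_set _ _ ((fun k : nat => l * k%:R) @` `I_M `|`
    (fun k : nat => - (l * k%:R)) @` `I_M)); last first.
  by rewrite finite_setU; split; apply: finite_image; exact: finite_II.
move=> _ [x _ <-]; have [i uE] := Vu x; have [j wE] := Vw x.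
have := hull_bounded x0 d_triangle x Eu Ew; rewrite uE wE => bd.
have {bd}bd : `|i%:R - j%:R| < M%:R :> R.
  apply: le_lt_trans MP; rewrite ler_pdivlMr// mulrC.
  by move: bd; rewrite -mulrBr normrM gtr0_norm.
have [ij|ji] := leqP j i.
- left; exists (i - j)%N; last by rewrite natrB// mulrBr.
  by move: bd; rewrite /= -natrB// normr_nat ltr_nat.
- right; exists (j - i)%N; last by rewrite natrB ?(ltnW ji)// mulrBr opprB.
  by move: bd; rewrite /= distrC -natrB ?(ltnW ji)// normr_nat ltr_nat.
Qed.

(** X may be infinite, so the supremum is a maximum because only finitely many values occur. The
    functions themselves may be unbounded, but relative to the embedded [x0] every vertex, hence
    every combination, takes finitely many values. *)
Lemma supdist_attained n n' (v : 'I_n -> F) (v' : 'I_n' -> F)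
    (t : 'I_n -> R) (t' : 'I_n' -> R) p p' :
  (forall i, V (v i)) -> (forall i, V (v' i)) ->
  convex_weights t -> convex_weights t' ->
  (forall x, p x = \sum_i t i * v i x) -> (forall x, p' x = \sum_i t' i * v' i x) ->
  is_max [set `|p x - p' x| | x in [set: X]] (D p p').
Proof.
move=> Vv Vv' [_ t1] [_ t1'] pE p'E.
pose w := embed d x0; have Vw : V w by apply: lattice_points_embed.
have frame k (tk : 'I_k -> R) (vk : 'I_k -> F) x : \sum_i tk i = 1 ->
    \sum_i tk i * (vk i x - w x) = \sum_i tk i * vk i x - w x.
  move=> tk1; under eq_bigr do rewrite mulrBr.
  by rewrite sumrB -mulr_suml tk1 mul1r.
have fin : finite_set [set `|p x - p' x| | x in [set: X]].
  apply: (@sub_finite_set _ _ [set `|ab.1 - ab.2| | ab in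
      range (fun x => \sum_i t i * (v i x - w x)) `*`
      range (fun x => \sum_i t' i * (v' i x - w x))]).
    move=> _ [x _ <-]; exists (\sum_i t i * (v i x - w x), \sum_i t' i * (v' i x - w x)).
      by split; exists x.
    by rewrite /= !frame// -pE -p'E opprB addrA subrK.
  apply: finite_image; apply: finite_setX; apply: finite_range_sum => i;
    exact: finite_range_lattice.
have ne : [set `|p x - p' x| | x in [set: X]] !=set0 by exists `|p x0 - p' x0|, x0.
have [a Aa ua] := finite_set_max fin ne.
rewrite /D /supdist; suff -> : sup [set `|p x - p' x| | x in [set: X]] = a by split.
by apply/eqP; rewrite eq_le ge_sup//=; apply: ub_le_sup => //; exists a.
Qed.

End Subdivision.

Theorem theorem3p1 (R : realType) (X : Type) (e : rel X) (N : nat)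
    (HX : Helly_graph e)
    (Hdim : finite_combinatorial_dimension (@gmetric R X e))
    (HN : (1 <= N)%N) :
  let E : set (X -> R) := hull (@gmetric R X e) in
  let D : (X -> R) -> (X -> R) -> R := @supdist R X in
  let iota : X -> (X -> R) := embed (@gmetric R X e) in
  let l : R := (2 * N`!)%:R^-1 in
  exists O : simplicial_structure D E,
  let V : set (X -> R) := vertices O in
  [/\ forall s, simplices O s -> isometric_to_orthosimplex O l s,
      [/\ Helly_graph (edge_rel D l (V := V)),
          forall p q : V,
            D (val p) (val q) = l * gmetric R (edge_rel D l (V := V)) p q,
          (forall x, V (iota x)) /\
          (forall x y, D (iota x) (iota y) = gmetric R e x y)
        & V = [set p | E p /\
                forall x, exists k : nat, D p (iota x) = l * k%:R]],
      forall s n (v : 'I_n -> (X -> R)), simplices O s -> enumerates v s ->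
        (forall p, E p -> closed_simplex O s p ->
          exists! t : 'I_n -> R, convex_weights t /\
            forall x, D p (iota x) = \sum_i t i * D (v i) (iota x)) /\
        (forall t : 'I_n -> R, convex_weights t ->
          forall x,
            D (realize O (fun w => \sum_i t i * (w == v i)%:R)) (iota x)
            = \sum_i t i * D (v i) (iota x))
    & forall p p' s s' n n' (v : 'I_n -> (X -> R)) (v' : 'I_n' -> (X -> R))
        (t : 'I_n -> R) (t' : 'I_n' -> R),
        E p -> E p' ->
        simplices O s -> enumerates v s -> closed_simplex O s p ->
        simplices O s' -> enumerates v' s' -> closed_simplex O s' p' ->
        convex_weights t -> convex_weights t' ->
        (forall x, D p (iota x) = \sum_i t i * D (v i) (iota x)) ->
        (forall x, D p' (iota x) = \sum_i t' i * D (v' i) (iota x)) ->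
        is_max [set `|\sum_i \sum_i' t i * t' i' *
                       (D (v i) (iota x) - D (v' i') (iota x))|
               | x in [set: X]]
          (D p p')].
Proof.
move=> E D iota l.
have [cG _] := HX; have [_ _ [x0 _] _] := cG.
(* The factorial is absorbed into the integer metric, so that the metric of X is [l] times an even
   number. *)
pose m x y := (N`! * gdist e x y)%N.
have l0 : 0 < l by rewrite invr_gt0 ltr0n muln_gt0 fact_gt0.
have mxx x : m x x = 0%N by rewrite /m gdistxx// muln0.
have mC x y : m x y = m y x by rewrite /m gdistC.
have m_triangle x y z : (m x z <= m x y + m y z)%N.
  by rewrite /m -mulnDr leq_mul2l gdist_triangle ?orbT.
have dE : @gmetric R X e = fun x y => l * (2 * m x y)%:R.
  apply/funext => x; apply/funext => y; rewrite /gmetric /m mulnA natrM mulKf//.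
  by rewrite gt_eqF// ltr0n muln_gt0 fact_gt0.
have dxx x : gmetric R e x x = 0 by rewrite /gmetric gdistxx.
have dC x y : gmetric R e x y = gmetric R e y x by rewrite /gmetric gdistC.
have d_triangle x y z : gmetric R e x z <= gmetric R e x y + gmetric R e y z.
  by rewrite /gmetric -natrD ler_nat gdist_triangle.
pose V0 := lattice_points m l; pose K := chain_complex m l.
have EE : E = hull (fun x y => l * (2 * m x y)%:R) by rewrite /E dE.
have V0E p : V0 p -> E p by rewrite EE => -[].
have Kcomplex : abstract_complex E K.
  move=> s /(chain_complexP (l := l))[fs s0 sV sK]; split=> //.
  by move=> p /sV /V0E.
have bij : set_bij (geometric_realization K) E (@affine_realize R X).
  split.
  - by move=> t tK; rewrite EE; apply: affine_realize_hull.
  - by move=> t t' /set_mem tK /set_mem tK'; apply: (affine_realize_inj l0 tK tK').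
  (* Finite dimension enters here: only finitely many fold values occur, so the chain carrying [p]
     is finite. *)
  - move=> p; rewrite EE => Ep; have [n Hn] := Hdim.
    rewrite dE in Hn.
    have [t tK tp] := affine_realize_surj x0 l0 mxx Ep
      (finite_fold_values x0 l0 m_triangle Hn Ep).
    by exists t.
have vertex v : K [set v] -> affine_realize (fun w => (w == v)%:R) = v.
  move=> Kv; apply/funext => x; rewrite /affine_realize.
  rewrite -(@fsbig_widen _ _ _ _ [set v])//; last first.
    by move=> w [_ /eqP/negbTE wv] /=; rewrite wv mul0r.
  by rewrite fsbig_set1 eqxx mul1r.
have cont s : K s -> forall t, geometric_face K s t -> forall eps : R, 0 < eps ->
    exists2 eta : R, 0 < eta & forall t', geometric_face K s t' ->
      (forall v, `|t v - t' v| < eta) -> D (affine_realize t) (affine_realize t') < eps.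
  by move=> Ks t ts eps; apply: (affine_realize_continuous x0 l0 Ks ts).
exists (SimplicialStructure Kcomplex bij vertex cont) => V.
have VV0 : V = V0.
  by apply/seteqP; split=> v; rewrite /V/vertices/= => /chain_complex1.
have Diota p x : E p -> D p (iota x) = p x.
  exact: (supdist_embed x0 dxx dC d_triangle).
have EV0 s n (v : 'I_n -> X -> R) i : K s -> enumerates v s -> V0 (v i).
  by move=> [_ _ sV _] [vs _ _]; apply/sV/vs.
split.
- by move=> s; apply: (face_isometry x0 l0 m_triangle).
- have iotaV x : V0 (iota x).
    by rewrite /V0 /iota dE; apply: lattice_points_embed.
  rewrite VV0; split.
  + exact: lattice_points_Helly.
  + by move=> p q; apply: (edge_gdist x0 l0 mxx mC m_triangle).
  + by split=> // x y; apply: (supdist_embed_embed x0 dxx dC d_triangle).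
  + apply/seteqP; split=> p.
      move=> V0p; have Ep := V0E _ V0p; split=> // x; rewrite Diota//.
      by case: V0p => _; apply.
    move=> [Ep kp]; split; first by rewrite EE in Ep.
    by move=> x; have [k] := kp x; rewrite Diota//; exists k.
- move=> s n v Ks vs.
  have vE i x : D (v i) (iota x) = v i x by apply/Diota/V0E/(EV0 s).
  have sv i : s (v i) by case: vs => + _ _; apply.
  split.
    move=> p Ep [t ts tp]; have {}tp : p = affine_realize t by rewrite -tp.
    have [tw tE] := face_weights vs ts.
    exists (t \o v); split.
      split=> // x; rewrite Diota// tp tE.
      by apply: eq_bigr => i _; rewrite vE.
    (* Weights giving the same distances to X realize the same function, so uniqueness is
       injectivity of the realization. *)
    move=> t' [tw' tE']; have [[tK' ts'] tE2] := vertex_weights_face l0 Ks sv tw'.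
    have tt' : t = vertex_weights v t'.
      apply: (affine_realize_inj l0 ts.1 tK'); rewrite -tp; apply/funext => x.
      rewrite tE2 -[LHS]Diota// tE'.
      by apply: eq_bigr => i _; rewrite vE.
    apply/funext => i /=; rewrite tt' vertex_weights_val//.
    exact: enumerates_inj vs.
  move=> t tw x; have [[tK ts] tE] := vertex_weights_face l0 Ks sv tw.
  have Et : E (affine_realize (vertex_weights v t)).
    by rewrite EE; apply: affine_realize_hull.
  rewrite (Diota _ _ Et) [LHS]tE.
  by apply: eq_bigr => i _; rewrite vE.
- move=> p p' s s' n n' v v' t t' Ep Ep' Ks vs _ Ks' vs' _ tw tw' pE p'E.
  have vE i x : D (v i) (iota x) = v i x by apply/Diota/V0E/(EV0 s).
  have vE' i x : D (v' i) (iota x) = v' i x by apply/Diota/V0E/(EV0 s').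
  have {}pE x : p x = \sum_i t i * v i x.
    by rewrite -Diota// pE; apply: eq_bigr => i _; rewrite vE.
  have {}p'E x : p' x = \sum_i t' i * v' i x.
    by rewrite -Diota// p'E; apply: eq_bigr => i _; rewrite vE'.
  have Vv i : V0 (v i) by apply: (EV0 s).
  have Vv' i : V0 (v' i) by apply: (EV0 s').
  have := supdist_attained x0 l0 mxx mC m_triangle Vv Vv' tw tw' pE p'E.
  congr (is_max _ _); apply: eq_imagel => x _; congr (`|_|).
  (* Both families of weights sum to 1, so the double sum collapses to [p x - p' x]. The absolute
     value has to stay outside: inside, the midpoint of an edge would be at positive distance from
     itself. *)
  rewrite pE p'E.
  under [RHS]eq_bigr => i _ do under eq_bigr => j _ do rewrite vE vE' mulrBr.
  under [RHS]eq_bigr => i _ do rewrite sumrB.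
  rewrite sumrB; congr (_ - _).
    apply: eq_bigr => i _; under eq_bigr => j _ do rewrite mulrAC.
    by rewrite -mulr_sumr tw'.2 mulr1.
  rewrite exchange_big/=; apply: eq_bigr => j _.
  under eq_bigr => i _ do rewrite -mulrA.
  by rewrite -mulr_suml tw.2 mul1r.
Qed.
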